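(* The twisted product Finsler manifold $(M_1\times_fM_2,F)$ is weakly Berwald if and only if $(M_1,F_1)$ is weakly Berwald, $I^hf_h=0$, and the following holds: $$E_{\alpha\beta}=-\tfrac12f^{-1}I^\nu_{;\alpha;\beta}f_\nu F_2^2-f^{-1}f_\nu\big(C^{\gamma\nu}_{\alpha;\beta}v_\gamma+I^\nu_{;\alpha}v_\beta+I^\nu_{;\beta}v_\alpha+C^\nu_{\alpha\beta}+I^\nu g_{\alpha\beta}\big).$$
   Context: Let $(M_1,F_1)$, $(M_2,F_2)$ be Finsler manifolds (metrics smooth on the slit tangent bundle, positively 1-homogeneous on fibres, with positive definite fundamental tensor) and $f:M_1\times M_2\to\mathbb{R}^+$ smooth. The twisted product $M_1\times_f M_2$ is $M=M_1\times M_2$ with $F=\sqrt{F_1^2(x,y)+f^2(x,u)F_2^2(u,v)}$, considered where $y\ne0$, $v\ne 0$. Local coordinates are $(x^i,u^\alpha)$ with fibre coordinates $(y^i,v^\alpha)$; Latin indices refer to $M_1$, Greek to $M_2$. For a Finsler metric $F$ with $g_{ij}=\frac12(F^2)_{y^iy^j}$, the spray coefficients are $G^i=\frac14g^{il}\big(\frac{\partial^2F^2}{\partial x^k\partial y^l}y^k-\frac{\partial F^2}{\partial x^l}\big)$, Berwald curvature $B^i_{\ jkl}=\frac{\partial^3G^i}{\partial y^j\partial y^k\partial y^l}$, mean Berwald curvature $E_{jk}=\frac12B^m_{\ jkm}$; $F$ is weakly Berwald if $E_{jk}=0$. $E_{\alpha\beta}$ is the mean Berwald curvature of $F_2$. For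 $F_2$: $g_{\alpha\beta}=\frac12(F_2^2)_{v^\alpha v^\beta}$, $v_\alpha=g_{\alpha\beta}v^\beta$, $C_{\alpha\beta\gamma}=\frac12\frac{\partial g_{\alpha\beta}}{\partial v^\gamma}$, $C^\nu_{\alpha\beta}=g^{\nu\mu}C_{\mu\alpha\beta}$, $C^{\gamma\nu}_\alpha=g^{\gamma\mu}g^{\nu\kappa}C_{\mu\kappa\alpha}$, $I^\nu=C^{\gamma\nu}_\gamma$ (raised mean Cartan torsion); $;\beta$ denotes $\partial/\partial v^\beta$. Similarly $I^h=C^{kh}_k$ for $F_1$. $f_h=\partial f/\partial x^h$, $f_\nu=\partial f/\partial u^\nu$. *)

(* Defs.v *)
From HB Require Import structures.
From mathcomp Require Import all_boot all_order all_algebra.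
From mathcomp Require Import all_classical all_reals.
From mathcomp Require Import topology normedtype derive.

Set Implicit Arguments.
Unset Strict Implicit.
Unset Printing Implicit Defensive.

Import Order.TTheory GRing.Theory Num.Theory.
Import numFieldNormedType.Exports.

Local Open Scope classical_set_scope.
Local Open Scope ring_scope.

Section Smoothness.
Context {R : realType} {n : nat}.
Implicit Types (f : 'rV[R]_n -> R) (U : set 'rV[R]_n).

Definition partial (i : 'I_n) f : 'rV[R]_n -> R :=
  fun x => 'D_(delta_mx 0 i) f x.

Definition partials (s : seq 'I_n) f : 'rV[R]_n -> R := foldr partial f s.

(* C^oo on an open set U; f may be arbitrary outside U. *)
Definition smooth_on U f : Prop :=
  forall (s : seq 'I_n) (x : 'rV[R]_n), U x ->
    {for x, continuous (partials s f)} /\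
    forall i : 'I_n, derivable (partials s f) x (delta_mx 0 i).

End Smoothness.

(* Smooth manifolds are given by an atlas. [coord c] and [point c] are mutually
   inverse between [chart_dom c] and [chart_img c], arbitrary elsewhere. *)
Record manifold (R : realType) (n : nat) := Manifold {
  mcarrier :> topologicalType;
  mfd_hausdorff : hausdorff_space mcarrier;
  mfd_second_countable : @second_countable mcarrier;
  mfd_nonempty : [set: mcarrier] !=set0;
  chart : Type;
  chart_dom : chart -> set mcarrier;
  chart_img : chart -> set 'rV[R]_n;
  coord : chart -> mcarrier -> 'rV[R]_n;
  point : chart -> 'rV[R]_n -> mcarrier;
  chart_dom_open : forall c, open (chart_dom c);
  chart_img_open : forall c, open (chart_img c);
  coord_img : forall c p, chart_dom c p -> chart_img c (coord c p);
  point_dom : forall c x, chart_img c x -> chart_dom c (point c x);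
  coordK : forall c p, chart_dom c p -> point c (coord c p) = p;
  pointK : forall c x, chart_img c x -> coord c (point c x) = x;
  coord_continuous : forall c p, chart_dom c p -> {for p, continuous (coord c)};
  point_continuous : forall c x, chart_img c x -> {for x, continuous (point c)};
  chart_cover : forall p, exists c, chart_dom c p;
  transition_smooth : forall c d (j : 'I_n),
    smooth_on [set x | chart_img c x /\ chart_dom d (point c x)]
              (fun x => coord d (point c x) 0 j)
}.

Arguments chart {R n} _.

Definition smooth_fun (R : realType) (n : nat) (M : manifold R n) (f : M -> R) :
    Prop :=
  forall c : chart M, smooth_on (chart_img c) (fun x => f (point c x)).

Section ProductManifold.
Context {R : realType} {n1 n2 : nat}.

Lemma lsubmx_continuous : continuous (@lsubmx R 1 n1 n2).
Proof.
move=> z A [P Pz PA].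
exists (fun i j => match fintype.split j with inl k => P i k | inr _ => setT end).
  move=> i j; case: splitP => k jk; last exact: filterT.
  have -> : j = lshift n2 k by exact: val_inj.
  by have := Pz i k; rewrite mxE.
move=> w Hw; apply: PA => i j; rewrite mxE.
by have := Hw i (lshift n2 j); rewrite (unsplitK (inl _ j)).
Qed.

Lemma rsubmx_continuous : continuous (@rsubmx R 1 n1 n2).
Proof.
move=> z A [P Pz PA].
exists (fun i j => match fintype.split j with inl _ => setT | inr k => P i k end).
  move=> i j; case: splitP => k jk; first exact: filterT.
  have -> : j = rshift n1 k by exact: val_inj.
  by have := Pz i k; rewrite mxE.
move=> w Hw; apply: PA => i j; rewrite mxE.
by have := Hw i (rshift n1 j); rewrite (unsplitK (inr _ j)).
Qed.

Lemma row_mx_continuous :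
  continuous (fun p : 'rV[R]_n1 * 'rV[R]_n2 => row_mx p.1 p.2).
Proof.
move=> [x y] A [P Pz PA].
exists ([set a : 'rV[R]_n1 | forall i j, P i (lshift n2 j) (a i j)],
        [set b : 'rV[R]_n2 | forall i j, P i (rshift n1 j) (b i j)]).
  split => /=.
  - exists (fun i j => P i (lshift n2 j)) => // i j.
    by have := Pz i (lshift n2 j); rewrite /= row_mxEl.
  - exists (fun i j => P i (rshift n1 j)) => // i j.
    by have := Pz i (rshift n1 j); rewrite /= row_mxEr.
move=> [a b] [/= Ha Hb]; apply: PA => i j /=.
rewrite -[j]splitK; case: (fintype.split j) => k /=.
- by rewrite row_mxEl.
- by rewrite row_mxEr.
Qed.

Lemma partials0 m (s : seq 'I_m) : partials s (fun=> 0 : R) = fun=> 0.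
Proof.
by elim: s => //= i s ->; apply/funext => x; rewrite /partial derive_cst.
Qed.

Lemma partial_lsubmx (i : 'I_(n1 + n2)) (f : 'rV[R]_n1 -> R) :
  partial i (fun z : 'rV[R]_(n1 + n2) => f (lsubmx z)) =
  match fintype.split i with
  | inl k => fun z => partial k f (lsubmx z)
  | inr _ => fun=> 0 end.
Proof.
rewrite -[i]splitK; case: (fintype.split i) => k; rewrite unsplitK /=; apply/funext => z.
- rewrite /partial /derive; congr (lim (_ @ 0^')); apply/funext => h /=.
  congr (_ *: (f _ - _)); rewrite linearD linearZ /=; congr (_ *: _ + _).
  by apply/rowP => j; rewrite !mxE (inj_eq (@lshift_inj _ _)).
- rewrite /partial /derive.
  rewrite (_ : (fun h => _) = fun=> 0) ?lim_cst //.
  apply/funext => h /=.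
  suff -> : lsubmx (h *: delta_mx 0 (rshift n1 k) + z) = lsubmx z.
    by rewrite subrr scaler0.
  apply/rowP => j; rewrite !mxE.
  by rewrite (_ : (lshift n2 j == rshift n1 k) = false) ?andbF ?mulr0 ?add0r //;
    exact: eq_lrshift.
Qed.

Lemma partial_rsubmx (i : 'I_(n1 + n2)) (f : 'rV[R]_n2 -> R) :
  partial i (fun z : 'rV[R]_(n1 + n2) => f (rsubmx z)) =
  match fintype.split i with
  | inl _ => fun=> 0
  | inr k => fun z => partial k f (rsubmx z) end.
Proof.
rewrite -[i]splitK; case: (fintype.split i) => k; rewrite unsplitK /=; apply/funext => z.
- rewrite /partial /derive.
  rewrite (_ : (fun h => _) = fun=> 0) ?lim_cst //.
  apply/funext => h /=.
  suff -> : rsubmx (h *: delta_mx 0 (lshift n2 k) + z) = rsubmx z.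
    by rewrite subrr scaler0.
  apply/rowP => j; rewrite !mxE.
  by rewrite (_ : (rshift n1 j == lshift n2 k) = false) ?andbF ?mulr0 ?add0r //;
    exact: eq_rlshift.
- rewrite /partial /derive; congr (lim (_ @ 0^')); apply/funext => h /=.
  congr (_ *: (f _ - _)); rewrite linearD linearZ /=; congr (_ *: _ + _).
  by apply/rowP => j; rewrite !mxE (inj_eq (@rshift_inj _ _)).
Qed.

Lemma smooth_on_lsubmx (U : set 'rV[R]_n1) (f : 'rV[R]_n1 -> R) :
  smooth_on U f ->
  smooth_on [set z : 'rV[R]_(n1 + n2) | U (lsubmx z)] (fun z => f (lsubmx z)).
Proof.
move=> fU s z Uz.
have [-> | [t ->]] : partials s (fun z : 'rV[R]_(n1 + n2) => f (lsubmx z)) =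
    (fun=> 0) \/ exists t, partials s (fun z : 'rV[R]_(n1 + n2) => f (lsubmx z))
    = fun z => partials t f (lsubmx z).
  elim: s => [|i s [IH|[t IH]]] /=; first by right; exists [::].
  - by left; rewrite IH; exact: (partials0 [:: i]).
  - rewrite IH partial_lsubmx; case: (fintype.split i) => k; last by left.
    by right; exists (k :: t).
- by split; [exact: cst_continuous | move=> i; exact: derivable_cst].
have [ct dt] := fU t _ Uz; split.
  exact: (@continuous_comp _ _ _ lsubmx (partials t f) z (@lsubmx_continuous z)).
move=> i; rewrite -[i]splitK; case: (fintype.split i) => k /=.
- rewrite /derivable (_ : (fun h => _) =
      fun h : R => h^-1 *: ((partials t f \o shift (lsubmx z))
        (h *: delta_mx 0 k) - partials t f (lsubmx z))); first exact: dt k.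
  apply/funext => h /=.
  congr (_ *: (partials t f _ - _)); rewrite linearD linearZ /=.
  congr (_ *: _ + _); apply/rowP => j.
  by rewrite !mxE (inj_eq (@lshift_inj _ _)).
- rewrite /derivable (_ : (fun h => _) = fun=> 0); first exact: is_cvg_cst.
  apply/funext => h /=.
  suff -> : lsubmx (h *: delta_mx 0 (rshift n1 k) + z) = lsubmx z.
    by rewrite subrr scaler0.
  apply/rowP => j; rewrite !mxE.
  by rewrite (_ : (lshift n2 j == rshift n1 k) = false) ?andbF ?mulr0 ?add0r //;
    exact: eq_lrshift.
Qed.

Lemma smooth_on_rsubmx (U : set 'rV[R]_n2) (f : 'rV[R]_n2 -> R) :
  smooth_on U f ->
  smooth_on [set z : 'rV[R]_(n1 + n2) | U (rsubmx z)] (fun z => f (rsubmx z)).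
Proof.
move=> fU s z Uz.
have [-> | [t ->]] : partials s (fun z : 'rV[R]_(n1 + n2) => f (rsubmx z)) =
    (fun=> 0) \/ exists t, partials s (fun z : 'rV[R]_(n1 + n2) => f (rsubmx z))
    = fun z => partials t f (rsubmx z).
  elim: s => [|i s [IH|[t IH]]] /=; first by right; exists [::].
  - by left; rewrite IH; exact: (partials0 [:: i]).
  - rewrite IH partial_rsubmx; case: (fintype.split i) => k; first by left.
    by right; exists (k :: t).
- by split; [exact: cst_continuous | move=> i; exact: derivable_cst].
have [ct dt] := fU t _ Uz; split.
  exact: (@continuous_comp _ _ _ rsubmx (partials t f) z (@rsubmx_continuous z)).
move=> i; rewrite -[i]splitK; case: (fintype.split i) => k /=.
- rewrite /derivable (_ : (fun h => _) = fun=> 0); first exact: is_cvg_cst.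
  apply/funext => h /=.
  suff -> : rsubmx (h *: delta_mx 0 (lshift n2 k) + z) = rsubmx z.
    by rewrite subrr scaler0.
  apply/rowP => j; rewrite !mxE.
  by rewrite (_ : (rshift n1 j == lshift n2 k) = false) ?andbF ?mulr0 ?add0r //;
    exact: eq_rlshift.
- rewrite /derivable (_ : (fun h => _) =
      fun h : R => h^-1 *: ((partials t f \o shift (rsubmx z))
        (h *: delta_mx 0 k) - partials t f (rsubmx z))); first exact: dt k.
  apply/funext => h /=.
  congr (_ *: (partials t f _ - _)); rewrite linearD linearZ /=.
  congr (_ *: _ + _); apply/rowP => j.
  by rewrite !mxE (inj_eq (@rshift_inj _ _)).
Qed.

Lemma smooth_onW m (U V : set 'rV[R]_m) (f : 'rV[R]_m -> R) :
  V `<=` U -> smooth_on U f -> smooth_on V f.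
Proof. by move=> VU fU s x /VU; exact: fU. Qed.

Variables (M1 : manifold R n1) (M2 : manifold R n2).

Lemma prod_hausdorff : hausdorff_space (M1 * M2)%type.
Proof.
move=> [p1 p2] [q1 q2] pq; congr (_, _).
- apply: (@mfd_hausdorff _ _ M1) => A B Ap Bq.
  have [|| [a b] [/= [Aa _] [Ba _]]] := pq (A `*` setT) (B `*` setT).
  + by exists (A, setT) => //; split => //=; exact: filterT.
  + by exists (B, setT) => //; split => //=; exact: filterT.
  by exists a.
- apply: (@mfd_hausdorff _ _ M2) => A B Ap Bq.
  have [|| [a b] [/= [_ Aa] [_ Ba]]] := pq (setT `*` A) (setT `*` B).
  + by exists (setT, A) => //; split => //=; exact: filterT.
  + by exists (setT, B) => //; split => //=; exact: filterT.
  by exists b.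
Qed.

Lemma prod_second_countable : @second_countable (M1 * M2)%type.
Proof.
have [B1 cB1 [oB1 bB1]] := @mfd_second_countable _ _ M1.
have [B2 cB2 [oB2 bB2]] := @mfd_second_countable _ _ M2.
exists [set P.1 `*` P.2 | P in B1 `*` B2].
  apply: (card_le_trans (card_image_le _ _)).
  exact: countableX.
split.
  move=> _ [[A1 A2] [/= /oB1 o1 /oB2 o2] <-].
  rewrite openE => -[x1 x2] [/= A1x A2x].
  by exists (A1, A2) => //; split; exact: open_nbhs_nbhs.
move=> [x1 x2] V [[V1 V2] /= [Vx1 Vx2] V12].
have [A1 [B1A A1x A1V]] := bB1 x1 V1 Vx1.
have [A2 [B2A A2x A2V]] := bB2 x2 V2 Vx2.
exists (A1 `*` A2); last first.
  by move=> [a b] [/= /A1V ? /A2V ?]; exact: V12.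
by split => //; exists (A1, A2).
Qed.

Let pdom (c : chart M1 * chart M2) : set (M1 * M2) :=
  chart_dom c.1 `*` chart_dom c.2.
Let pimg (c : chart M1 * chart M2) : set 'rV[R]_(n1 + n2) :=
  [set z | chart_img c.1 (lsubmx z) /\ chart_img c.2 (rsubmx z)].
Let pcoord (c : chart M1 * chart M2) (p : M1 * M2) : 'rV[R]_(n1 + n2) :=
  row_mx (coord c.1 p.1) (coord c.2 p.2).
Let ppoint (c : chart M1 * chart M2) (z : 'rV[R]_(n1 + n2)) : M1 * M2 :=
  (point c.1 (lsubmx z), point c.2 (rsubmx z)).

Lemma prod_nonempty : [set: M1 * M2] !=set0.
Proof.
have [p _] := @mfd_nonempty _ _ M1; have [q _] := @mfd_nonempty _ _ M2.
by exists (p, q).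
Qed.

Lemma pdom_open c : open (pdom c).
Proof.
rewrite openE => -[p q] [/= cp cq].
exists (chart_dom c.1, chart_dom c.2) => //.
by split; apply: open_nbhs_nbhs; split => //; exact: chart_dom_open.
Qed.

Lemma pimg_open c : open (pimg c).
Proof.
apply: (@openI _ (lsubmx @^-1` chart_img c.1) (rsubmx @^-1` chart_img c.2)).
- by apply: open_comp; [move=> ? _; exact: lsubmx_continuous
                       | exact: chart_img_open].
- by apply: open_comp; [move=> ? _; exact: rsubmx_continuous
                       | exact: chart_img_open].
Qed.

Lemma pcoord_img c p : pdom c p -> pimg c (pcoord c p).
Proof.
by move=> [? ?]; rewrite /pimg/= row_mxKl row_mxKr; split; exact: coord_img.
Qed.

Lemma ppoint_dom c z : pimg c z -> pdom c (ppoint c z).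
Proof. by move=> [? ?]; split; exact: point_dom. Qed.

Lemma pcoordK c p : pdom c p -> ppoint c (pcoord c p) = p.
Proof.
by case: p => p q [/= ? ?]; rewrite /ppoint row_mxKl row_mxKr !coordK.
Qed.

Lemma ppointK c z : pimg c z -> pcoord c (ppoint c z) = z.
Proof. by move=> [? ?]; rewrite /pcoord/= !pointK // hsubmxK. Qed.

Lemma pcoord_continuous c p : pdom c p -> {for p, continuous (pcoord c)}.
Proof.
case: p => p q [/= cp cq].
apply: (@continuous_comp _ _ _ (fun r : M1 * M2 => (coord c.1 r.1, coord c.2 r.2))
  (fun r => row_mx r.1 r.2)); last exact: row_mx_continuous.
move=> A [[A1 A2] [/= A1x A2x] A12].
exists (coord c.1 @^-1` A1, coord c.2 @^-1` A2).
  by split; [exact: coord_continuous cp _ A1x | exact: coord_continuous cq _ A2x].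
by move=> [a b] [/= ? ?]; exact: A12.
Qed.

Lemma ppoint_continuous c z : pimg c z -> {for z, continuous (ppoint c)}.
Proof.
move=> [cx cu].
move=> A [[A1 A2] [/= A1x A2x] A12].
have P1 : nbhs z [set w | A1 (point c.1 (lsubmx w))].
  exact: (lsubmx_continuous (point_continuous cx A1x)).
have P2 : nbhs z [set w | A2 (point c.2 (rsubmx w))].
  exact: (rsubmx_continuous (point_continuous cu A2x)).
apply: (@filterS _ _ (nbhs_filter z) _ _ _ (filterI P1 P2)) => w [/= ? ?].
exact: A12.
Qed.

Lemma pchart_cover p : exists c, pdom c p.
Proof.
have [c1 ?] := chart_cover p.1; have [c2 ?] := chart_cover p.2.
by exists (c1, c2).
Qed.

Lemma ptransition_smooth c d (j : 'I_(n1 + n2)) :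
  smooth_on [set z | pimg c z /\ pdom d (ppoint c z)]
            (fun z => pcoord d (ppoint c z) 0 j).
Proof.
rewrite -[j]splitK; case: (fintype.split j) => k /=.
- rewrite (_ : (fun z => _) =
      fun z => coord d.1 (point c.1 (lsubmx z)) 0 k); last first.
    by apply/funext => z; rewrite /pcoord row_mxEl.
  by apply: (smooth_onW _ (smooth_on_lsubmx (@transition_smooth _ _ M1 c.1 d.1 k)))
    => z [[? ?] [? ?]].
- rewrite (_ : (fun z => _) =
      fun z => coord d.2 (point c.2 (rsubmx z)) 0 k); last first.
    by apply/funext => z; rewrite /pcoord row_mxEr.
  by apply: (smooth_onW _ (smooth_on_rsubmx (@transition_smooth _ _ M2 c.2 d.2 k)))
    => z [[? ?] [? ?]].
Qed.

Definition prod_manifold : manifold R (n1 + n2) :=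
  @Manifold R (n1 + n2) (M1 * M2)%type prod_hausdorff prod_second_countable
    prod_nonempty (chart M1 * chart M2)%type pdom pimg pcoord ppoint
    pdom_open pimg_open pcoord_img ppoint_dom pcoordK ppointK
    pcoord_continuous ppoint_continuous pchart_cover ptransition_smooth.

End ProductManifold.

(* Coordinate expressions of the Finsler tensors, for F = F(x, y) written in a
   chart, x the base point and y the fibre coordinates. *)
Section FinslerTensors.
Context {R : realType} {n : nat}.
Implicit Types (h F : 'rV[R]_n -> 'rV[R]_n -> R).

Definition pdx (k : 'I_n) h : 'rV[R]_n -> 'rV[R]_n -> R :=
  fun x y => partial k (fun x' => h x' y) x.

Definition pdy (k : 'I_n) h : 'rV[R]_n -> 'rV[R]_n -> R :=
  fun x y => partial k (h x) y.

Definition energy F : 'rV[R]_n -> 'rV[R]_n -> R := fun x y => F x y ^+ 2.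

(* g_ij *)
Definition fund F (x y : 'rV[R]_n) : 'M[R]_n :=
  \matrix_(i, j) (2^-1 * pdy j (pdy i (energy F)) x y).

(* g^ij *)
Definition fund_inv F (x y : 'rV[R]_n) : 'M[R]_n := invmx (fund F x y).

(* y_i *)
Definition lower F (i : 'I_n) : 'rV[R]_n -> 'rV[R]_n -> R :=
  fun x y => \sum_j fund F x y i j * y 0 j.

(* G^i *)
Definition spray F (i : 'I_n) : 'rV[R]_n -> 'rV[R]_n -> R :=
  fun x y => 4^-1 * \sum_l fund_inv F x y i l *
    (\sum_k pdx k (pdy l (energy F)) x y * y 0 k - pdx l (energy F) x y).

(* B^i_jkl *)
Definition berwald F (i j k l : 'I_n) : 'rV[R]_n -> 'rV[R]_n -> R :=
  pdy j (pdy k (pdy l (spray F i))).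

(* E_jk *)
Definition mean_berwald F (j k : 'I_n) : 'rV[R]_n -> 'rV[R]_n -> R :=
  fun x y => 2^-1 * \sum_m berwald F m j k m x y.

(* C_ijk *)
Definition cartan F (i j k : 'I_n) : 'rV[R]_n -> 'rV[R]_n -> R :=
  fun x y => 2^-1 * pdy k (fun x' y' => fund F x' y' i j) x y.

(* C^i_jk *)
Definition cartan1 F (i j k : 'I_n) : 'rV[R]_n -> 'rV[R]_n -> R :=
  fun x y => \sum_m fund_inv F x y i m * cartan F m j k x y.

(* C^ij_k *)
Definition cartan2 F (i j k : 'I_n) : 'rV[R]_n -> 'rV[R]_n -> R :=
  fun x y => \sum_m \sum_l
    fund_inv F x y i m * fund_inv F x y j l * cartan F m l k x y.

(* I^h *)
Definition mean_cartan F (h : 'I_n) : 'rV[R]_n -> 'rV[R]_n -> R :=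
  fun x y => \sum_k cartan2 F k h k x y.

End FinslerTensors.

Section FinslerManifolds.
Context {R : realType} {n : nat}.
Implicit Type M : manifold R n.

(* The expression in chart d of the tangent vector with coordinates y at x in
   chart c. *)
Definition tangent_change M (c d : chart M) (x y : 'rV[R]_n) : 'rV[R]_n :=
  \row_j \sum_k partial k (fun x' => coord d (point c x') 0 j) x * y 0 k.

(* A function on TM is given by its expressions F c x y in the charts c, which
   must agree under changes of chart. *)
Record finsler_metric M := FinslerMetric {
  finsler_fun :> forall c : chart M, 'rV[R]_n -> 'rV[R]_n -> R;
  finsler_compat : forall (c d : chart M) x y,
    chart_img c x -> chart_dom d (point c x) ->
    finsler_fun d (coord d (point c x)) (tangent_change c d x y)
      = finsler_fun c x y;
  finsler_ge0 : forall (c : chart M) x y,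
    chart_img c x -> 0 <= finsler_fun c x y;
  finsler_smooth : forall c : chart M,
    smooth_on [set z : 'rV[R]_(n + n) | chart_img c (lsubmx z) /\ rsubmx z != 0]
              (fun z => finsler_fun c (lsubmx z) (rsubmx z));
  finsler_homog : forall (c : chart M) x y (l : R), chart_img c x -> 0 < l ->
    finsler_fun c x (l *: y) = l * finsler_fun c x y;
  finsler_posdef : forall (c : chart M) x y (w : 'rV[R]_n),
    chart_img c x -> y != 0 -> w != 0 ->
    0 < \sum_i \sum_j fund (finsler_fun c) x y i j * w 0 i * w 0 j
}.

Definition slit : set 'rV[R]_n := [set y | y != 0].

(* A is the set of admissible fibre coordinates: [slit] for a Finsler metric,
   smaller for a metric considered on part of the slit tangent bundle only. *)
Definition weakly_berwald M (A : set 'rV[R]_n)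
    (F : chart M -> 'rV[R]_n -> 'rV[R]_n -> R) : Prop :=
  forall (c : chart M) (x y : 'rV[R]_n), chart_img c x -> A y ->
    forall j k : 'I_n, mean_berwald (F c) j k x y = 0.

End FinslerManifolds.

Section TwistedProduct.
Context {R : realType} {n1 n2 : nat}.
Variables (M1 : manifold R n1) (M2 : manifold R n2).

Definition twisted_slit : set 'rV[R]_(n1 + n2) :=
  [set w | lsubmx w != 0 /\ rsubmx w != 0].

Definition twisted (F1 : finsler_metric M1) (F2 : finsler_metric M2)
    (f : prod_manifold M1 M2 -> R) (c : chart (prod_manifold M1 M2))
    (z w : 'rV[R]_(n1 + n2)) : R :=
  Num.sqrt (F1 c.1 (lsubmx z) (lsubmx w) ^+ 2 +
    f (point c z) ^+ 2 * F2 c.2 (rsubmx z) (rsubmx w) ^+ 2).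

(* f(x, u), f_h and f_nu in the product chart (c1, c2). *)
Definition floc (f : prod_manifold M1 M2 -> R) (c1 : chart M1) (c2 : chart M2)
    (x : 'rV[R]_n1) (u : 'rV[R]_n2) : R :=
  f (point c1 x, point c2 u).

Definition df1 (f : prod_manifold M1 M2 -> R) c1 c2 (h : 'I_n1) x u : R :=
  partial h (fun x' => floc f c1 c2 x' u) x.

Definition df2 (f : prod_manifold M1 M2 -> R) c1 c2 (nu : 'I_n2) x u : R :=
  partial nu (fun u' => floc f c1 c2 x u') u.

End TwistedProduct.

(* Main.v *)
(* On the part y != 0, v != 0 the energy of the twisted product splits as
   F1^2 + f^2 F2^2, so its fundamental tensor is block diagonal and the sprays are
     G^i = G1^i - (1/2) f f_l g^{il} F2^2,
     G^a = G2^a + f^{-1} (f_k y^k + f_b v^b) v^a - (1/2) f^{-1} g^{ab} f_b F2^2.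
   The mean Berwald curvature is half the fibre Hessian of the divergence of the
   spray.  Since d_i g^{il} = -2 I^l, that divergence is, up to linear terms,
     div G1 + div G2 + f (I^l f_l) F2^2 + f^{-1} (I^nu f_nu) F2^2.
   Its (y,y) block vanishes iff F1 is weakly Berwald and I^l f_l has zero Hessian
   (rescale v), its (y,v) block vanishes iff d_j (I^l f_l) = 0, which by Euler's
   theorem in degree -1 means I^l f_l = 0, and what is left of the (v,v) block is
   the stated formula, because C^{gamma nu}_{alpha;beta} v_gamma and
   C^nu_{alpha beta} cancel. *)
Require Import Defs.
From HB Require Import structures.
From mathcomp Require Import all_boot all_order all_algebra.
From mathcomp Require Import all_classical all_reals.
From mathcomp Require Import topology normedtype derive.
From mathcomp Require Import ring.

Set Implicit Arguments.
Unset Strict Implicit.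
Unset Printing Implicit Defensive.

Import Order.TTheory GRing.Theory Num.Theory.
Import numFieldNormedType.Exports.

Local Open Scope classical_set_scope.
Local Open Scope ring_scope.

(** * Partial derivatives and smooth functions *)

(** Smoothness means that all iterated coordinate partials exist and are continuous; Fréchet
    differentiability is not part of it. Symmetry of second derivatives and Euler's theorem, which
    differentiates in the direction y rather than along an axis, are therefore derived from the mean
    value theorem on segments. The data are smooth only over chart images and off the zero section,
    so every identity is differentiated on an open set. The twisted metric is a square root, but the
    tensors see only F^2, so the root itself is never differentiated. Over a fixed base point f and
    its first derivatives are constants, and the spray components and their divergence have the
    shape P(y) + Q(v) + a(y) b(v). This shape is stable under fibre derivatives, so the Hessian
    blocks can be read off; in the divergence the coupling has a = I^h f_h and b = f F_2^2. The
    equivalence is proved at each base point separately, and the two positive dimensions provide the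
    nonzero test vectors that detach the conditions on one factor from the other. *)

Section PartialRules.
Context {R : realType} {n : nat}.
Implicit Types (f g : 'rV[R]_n -> R) (U : set 'rV[R]_n) (x v : 'rV[R]_n).

Lemma eq_on_near U f g x : open U -> (forall y, U y -> f y = g y) -> U x ->
  \near x, f x = g x.
Proof.
move=> oU fg Ux; apply: filterS (fun y => fg y) _.
by apply: open_nbhs_nbhs; split.
Qed.

(** A derivative sees only the germ at the point, so an identity valid on an open set may be
    differentiated there. *)
Lemma eq_on_partial U f g x i : open U -> (forall y, U y -> f y = g y) -> U x ->
  partial i f x = partial i g x.
Proof. by move=> oU fg Ux; apply/near_eq_derive/(eq_on_near oU fg). Qed.

Lemma eq_on_derivable U f g x v : open U -> (forall y, U y -> f y = g y) ->
  U x -> derivable f x v -> derivable g x v.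
Proof. by move=> oU fg Ux; apply/near_eq_derivable/(eq_on_near oU fg). Qed.

Lemma eq_on_continuous U f g x : open U -> (forall y, U y -> f y = g y) ->
  U x -> {for x, continuous f} -> {for x, continuous g}.
Proof.
move=> oU fg Ux cf; have := eq_on_near oU fg Ux => nfg.
rewrite /prop_for /continuous_at -(fg _ Ux).
exact: cvg_trans (near_eq_cvg nfg) cf.
Qed.

Lemma partialD f g x i :
  derivable f x (delta_mx 0 i) -> derivable g x (delta_mx 0 i) ->
  partial i (fun y => f y + g y) x = partial i f x + partial i g x.
Proof. exact: deriveD. Qed.

Lemma partialM f g x i :
  derivable f x (delta_mx 0 i) -> derivable g x (delta_mx 0 i) ->
  partial i (fun y => f y * g y) x = f x * partial i g x + g x * partial i f x.
Proof. exact: deriveM. Qed.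

Lemma partial_cst (c : R) x (i : 'I_n) : partial i (fun=> c) x = 0.
Proof. exact: derive_cst. Qed.

Lemma partialZ (c : R) f x i : derivable f x (delta_mx 0 i) ->
  partial i (fun y => c * f y) x = c * partial i f x.
Proof. by move=> df; rewrite partialM ?derivable_cst// partial_cst mulr0 addr0. Qed.

Lemma derivable_big I (r : seq I) (P : pred I) (F : I -> 'rV[R]_n -> R) x v :
  (forall j, P j -> derivable (F j) x v) ->
  derivable (fun y => \sum_(j <- r | P j) F j y) x v.
Proof.
move=> dF; elim: r => [|j r IH].
  rewrite (_ : (fun y => _) = cst 0); first exact: derivable_cst.
  by apply/funext => y; rewrite big_nil.
under eq_fun do rewrite big_cons.
by case: ifP => // Pj; apply: derivableD => //; exact: dF.
Qed.

Lemma partial_big I (r : seq I) (P : pred I) (F : I -> 'rV[R]_n -> R) x i :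
  (forall j, P j -> derivable (F j) x (delta_mx 0 i)) ->
  partial i (fun y => \sum_(j <- r | P j) F j y) x =
  \sum_(j <- r | P j) partial i (F j) x.
Proof.
move=> dF; elim: r => [|j r IH].
  rewrite big_nil (_ : (fun y => _) = cst 0); first exact: derive_cst.
  by apply/funext => y; rewrite big_nil.
rewrite big_cons; under eq_fun do rewrite big_cons.
case: ifP => // Pj; rewrite partialD ?IH //; first exact: dF.
exact: derivable_big.
Qed.

Lemma is_derive_coord (j : 'I_n) x v : is_derive x v (fun y => y 0 j) (v 0 j).
Proof.
have E : (fun h : R => h^-1 *: (((fun y => y 0 j) \o shift x) (h *: v) - x 0 j))
     @ 0^' --> v 0 j.
  (* A coordinate is linear, so its difference quotient is constant away from h = 0. *)
  apply: (@cvg_trans _ ((fun=> v 0 j) @ (0 : R)^')); last exact: cvg_cst.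
  apply: near_eq_cvg; near=> h.
  rewrite /= !mxE addrK [_ *: _]mulrA mulVf ?mul1r //.
  by near: h; exact: nbhs_dnbhs_neq.
by split; [apply/cvg_ex; exists (v 0 j)| exact: cvg_lim].
Unshelve. all: by end_near. Qed.

Lemma partial_coord (j i : 'I_n) x : partial i (fun y => y 0 j) x = (i == j)%:R.
Proof.
by rewrite /partial (@derive_val _ _ _ _ _ _ _ (is_derive_coord j x _)) mxE eqxx
  eq_sym.
Qed.

End PartialRules.

Section SmoothClosure.
Context {R : realType} {n : nat}.
Implicit Types (f g : 'rV[R]_n -> R) (U : set 'rV[R]_n) (x v : 'rV[R]_n).

(** [partials] adds derivatives on the outside, whereas [Ck] strips the innermost one. The Leibniz
    rule rewrites exactly that first derivative, so closure under products and inverses becomes an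
    induction on a finite order. *)
Fixpoint Ck (k : nat) U f : Prop :=
  if k is k'.+1 then
    (forall x, U x ->
       {for x, continuous f} /\ forall i, derivable f x (delta_mx 0 i)) /\
    (forall i, Ck k' U (partial i f))
  else True.

Lemma partials_rcons s (i : 'I_n) f : partials (rcons s i) f = partials s (partial i f).
Proof. by rewrite /partials foldr_rcons. Qed.

Lemma smooth_on_partial U f i : smooth_on U f -> smooth_on U (partial i f).
Proof. by move=> sf s x Ux; rewrite -partials_rcons; exact: sf. Qed.

Lemma smooth_onP U f : smooth_on U f <-> forall k, Ck k U f.
Proof.
split=> [sf k|Cf s].
  elim: k f sf => //= k IH f sf; split; first exact: (sf [::]).
  by move=> i; apply/IH/smooth_on_partial.
(* [Ck k] gives continuity and derivability only for partials of order below [k], so a word [s]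
   needs order one more than its length. *)
have {Cf} := Cf (size s).+1; elim/last_ind: s f => [|s i IH] f /=.
  by case.
by rewrite size_rcons partials_rcons => -[_ /(_ i)]; exact: IH.
Qed.

Lemma smooth_on_derivable U f x i : smooth_on U f -> U x ->
  derivable f x (delta_mx 0 i).
Proof. by move=> sf Ux; have [] := sf [::] x Ux. Qed.

Lemma smooth_on_continuous U f x : smooth_on U f -> U x -> {for x, continuous f}.
Proof. by move=> sf Ux; have [] := sf [::] x Ux. Qed.

Lemma CkW k U f : Ck k.+1 U f -> Ck k U f.
Proof.
elim: k f => // k IH f [H1 H2]; split => // i.
by apply: IH; exact: H2.
Qed.

Lemma eq_on_Ck k U f g : open U -> (forall y, U y -> f y = g y) ->
  Ck k U f -> Ck k U g.
Proof.
move=> oU; elim: k f g => //= k IH f g fg [H1 H2]; split.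
  move=> x Ux; have [c d] := H1 x Ux; split.
    exact: eq_on_continuous oU fg Ux c.
  by move=> i; exact: eq_on_derivable oU fg Ux (d i).
move=> i; apply: IH (H2 i) => y Uy; exact: eq_on_partial oU fg Uy.
Qed.

Lemma CkD k U f g : open U -> Ck k U f -> Ck k U g ->
  Ck k U (fun y => f y + g y).
Proof.
move=> oU; elim: k f g => //= k IH f g [f1 f2] [g1 g2]; split.
  move=> x Ux; have [cf df] := f1 x Ux; have [cg dg] := g1 x Ux; split.
    exact: (continuousD cf cg).
  by move=> i; exact: derivableD.
move=> i; apply: eq_on_Ck oU _ (IH _ _ (f2 i) (g2 i)) => x Ux.
have [_ df] := f1 x Ux; have [_ dg] := g1 x Ux.
by rewrite partialD.
Qed.

Lemma CkM k U f g : open U -> Ck k U f -> Ck k U g ->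
  Ck k U (fun y => f y * g y).
Proof.
move=> oU; elim: k f g => // k IH f g Cf Cg.
have [f1 f2] := Cf; have [g1 g2] := Cg; split.
  move=> x Ux; have [cf df] := f1 x Ux; have [cg dg] := g1 x Ux; split.
    exact: (continuousM cf cg).
  by move=> i; exact: derivableM.
move=> i.
apply: (@eq_on_Ck k U (fun x => f x * partial i g x + g x * partial i f x)) => //.
  move=> x Ux; have [_ df] := f1 x Ux; have [_ dg] := g1 x Ux.
  by rewrite partialM.
exact: CkD oU (IH _ _ (CkW Cf) (g2 i)) (IH _ _ (CkW Cg) (f2 i)).
Qed.

Lemma Ck_cst k U (c : R) : Ck k U (fun=> c).
Proof.
elim: k c => //= k IH c; split.
  by move=> x _; split; [exact: cst_continuous|move=> i; exact: derivable_cst].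
move=> i; rewrite (_ : partial i _ = fun=> 0) //.
by apply/funext => x; rewrite /partial derive_cst.
Qed.

Lemma CkV k U f : open U -> (forall x, U x -> f x != 0) -> Ck k U f ->
  Ck k U (fun y => (f y)^-1).
Proof.
move=> oU f0; elim: k => // k IH Cf; have [f1 f2] := Cf; split.
  move=> x Ux; have [cf df] := f1 x Ux; split.
    exact: (continuousV (f0 _ Ux) cf).
  by move=> i; apply: derivableV => //; exact: f0.
have Vk := IH (CkW Cf).
move=> i.
(* The derivative of 1/f is written as a product containing 1/f twice, so the induction hypothesis
   at order [k] and closure under products suffice. *)
apply: (@eq_on_Ck k U
  (fun x => -1 * ((f x)^-1 * (f x)^-1) * partial i f x)) => //.
  move=> x Ux; have [_ df] := f1 x Ux.
  transitivity (- (f x) ^- 2 * partial i f x).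
    by rewrite mulN1r expr2 invfM.
  by rewrite /partial deriveV //; exact: f0.
exact: CkM oU (CkM oU (Ck_cst _ _ _) (CkM oU Vk Vk)) (f2 i).
Qed.

Lemma smooth_onD U f g : open U -> smooth_on U f -> smooth_on U g ->
  smooth_on U (fun y => f y + g y).
Proof.
by move=> oU /smooth_onP sf /smooth_onP sg; apply/smooth_onP => k; exact: CkD.
Qed.

Lemma smooth_onM U f g : open U -> smooth_on U f -> smooth_on U g ->
  smooth_on U (fun y => f y * g y).
Proof.
by move=> oU /smooth_onP sf /smooth_onP sg; apply/smooth_onP => k; exact: CkM.
Qed.

Lemma smooth_onV U f : open U -> (forall x, U x -> f x != 0) -> smooth_on U f ->
  smooth_on U (fun y => (f y)^-1).
Proof. by move=> oU f0 /smooth_onP sf; apply/smooth_onP => k; exact: CkV. Qed.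

Lemma smooth_on_cst U (c : R) : smooth_on U (fun=> c).
Proof. by apply/smooth_onP => k; exact: Ck_cst. Qed.

Lemma smooth_onZ U (c : R) f : open U -> smooth_on U f ->
  smooth_on U (fun y => c * f y).
Proof. by move=> oU; apply: smooth_onM => //; exact: smooth_on_cst. Qed.

Lemma smooth_onN U f : open U -> smooth_on U f -> smooth_on U (fun y => - f y).
Proof. by move=> oU sf; under eq_fun do rewrite -mulN1r; exact: smooth_onZ. Qed.

Lemma smooth_onB U f g : open U -> smooth_on U f -> smooth_on U g ->
  smooth_on U (fun y => f y - g y).
Proof. by move=> oU sf sg; apply: smooth_onD => //; exact: smooth_onN. Qed.

Lemma eq_on_smooth U f g : open U -> (forall y, U y -> f y = g y) ->
  smooth_on U f -> smooth_on U g.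
Proof.
move=> oU fg /smooth_onP sf; apply/smooth_onP => k.
exact: eq_on_Ck oU fg (sf k).
Qed.

Lemma smooth_on_coord U (j : 'I_n) : smooth_on U (fun y => y 0 j).
Proof.
apply/smooth_onP => -[//|k]; split.
  move=> x _; split; first exact: coord_continuous.
  by move=> i; apply: (@ex_derive _ _ _ _ _ _ _ (is_derive_coord j x _)).
move=> i; rewrite (_ : partial i _ = fun=> (i == j)%:R); first exact: Ck_cst.
by apply/funext => x; rewrite partial_coord.
Qed.

Lemma smooth_on_sum I (r : seq I) (P : pred I) U (F : I -> 'rV[R]_n -> R) :
  open U -> (forall j, P j -> smooth_on U (F j)) ->
  smooth_on U (fun y => \sum_(j <- r | P j) F j y).
Proof.
move=> oU sF; elim: r => [|j r IH].
  under eq_fun do rewrite big_nil; exact: smooth_on_cst.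
under eq_fun do rewrite big_cons.
by case Pj: (P j) => //; apply: smooth_onD => //; exact: sF.
Qed.

Lemma smooth_on_prod I (r : seq I) (P : pred I) U (F : I -> 'rV[R]_n -> R) :
  open U -> (forall j, P j -> smooth_on U (F j)) ->
  smooth_on U (fun y => \prod_(j <- r | P j) F j y).
Proof.
move=> oU sF; elim: r => [|j r IH].
  under eq_fun do rewrite big_nil; exact: smooth_on_cst.
under eq_fun do rewrite big_cons.
by case Pj: (P j) => //; apply: smooth_onM => //; exact: sF.
Qed.

Lemma smooth_on_det m U (A : 'rV[R]_n -> 'M[R]_m) : open U ->
  (forall i j, smooth_on U (fun y => A y i j)) -> smooth_on U (fun y => \det (A y)).
Proof.
move=> oU sA; apply: smooth_on_sum => // s _; apply: smooth_onZ => //.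
exact: smooth_on_prod.
Qed.

Lemma smooth_on_invmx m U (A : 'rV[R]_n -> 'M[R]_m) : open U ->
  (forall y, U y -> A y \in unitmx) ->
  (forall i j, smooth_on U (fun y => A y i j)) ->
  forall i j, smooth_on U (fun y => invmx (A y) i j).
Proof.
move=> oU uA sA i j.
(* Cramer's rule: the entries of the inverse are polynomials in the entries of [A] divided by the
   determinant, which does not vanish on [U]. *)
apply: (@eq_on_smooth U (fun y => (\det (A y))^-1 * cofactor (A y) j i)) => //.
  by move=> y Uy; rewrite /invmx uA // !mxE.
apply: smooth_onM => //; first apply: smooth_onV => //.
- by move=> y /uA; rewrite unitmxE unitfE.
- exact: smooth_on_det.
apply: smooth_onZ => //; apply: smooth_on_det => // k l.
under eq_fun do rewrite !mxE; exact: sA.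
Qed.

End SmoothClosure.

(** * Symmetry of second derivatives and Euler's theorem *)

Section DirectionalDerivatives.
Context {R : realType} {V : normedModType R}.
Implicit Types (f : V -> R) (x v w : V).

Lemma is_derive_line f x v (s : R) : derivable f (x + s *: v) v ->
  is_derive s 1 (fun t : R => f (x + t *: v)) ('D_v f (x + s *: v)).
Proof.
move=> df.
have E : (fun h : R => h^-1 *: (((fun t : R => f (x + t *: v)) \o shift s)
      (h *: 1) - f (x + s *: v))) =
    (fun h : R => h^-1 *: ((f \o shift (x + s *: v)) (h *: v) - f (x + s *: v))).
  apply/funext => h /=; congr (_ *: (f _ - _)).
  by rewrite [h *: 1]mulr1 scalerDl addrCA.
by split; rewrite /derivable /derive E.
Qed.

(** Absolute values absorb the sign of [t], as increments in a punctured neighbourhood of 0 have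
    either sign. *)
Lemma mvt_line f x v (t : R) :
  (forall s, `|s| <= `|t| -> derivable f (x + s *: v) v) ->
  exists2 s, `|s| <= `|t| & f (x + t *: v) - f x = t * 'D_v f (x + s *: v).
Proof.
move=> df.
have [t0|t0] := lerP 0 t.
- have ts s : s \in `[0, t] -> `|s| <= `|t|.
    by rewrite in_itv /= => /andP[s0 st]; rewrite !ger0_norm.
  have [s st /=] : exists2 s, s \in `[0, t] &
      f (x + t *: v) - f (x + 0 *: v) = 'D_v f (x + s *: v) * (t - 0).
    apply: (@MVT_segment R (fun t : R => f (x + t *: v))
      (fun s => 'D_v f (x + s *: v))) => //.
      by move=> s /subset_itv_oo_cc st; apply/is_derive_line/df/ts.
    apply: derivable_within_continuous => s st.
    exact: (@ex_derive _ _ _ _ _ _ _ (is_derive_line (df s (ts s st)))).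
  by rewrite scale0r addr0 subr0 mulrC => ->; exists s => //; exact: ts.
- have ts s : s \in `[t, 0] -> `|s| <= `|t|.
    by rewrite in_itv /= => /andP[s0 st]; rewrite (ltr0_norm t0) ler0_norm // lerN2.
  have [s st /=] : exists2 s, s \in `[t, 0] &
      f (x + 0 *: v) - f (x + t *: v) = 'D_v f (x + s *: v) * (0 - t).
    apply: (@MVT_segment R (fun t : R => f (x + t *: v))
      (fun s => 'D_v f (x + s *: v))) => //; first exact: ltW.
      by move=> s /subset_itv_oo_cc st; apply/is_derive_line/df/ts.
    apply: derivable_within_continuous => s st.
    exact: (@ex_derive _ _ _ _ _ _ _ (is_derive_line (df s (ts s st)))).
  rewrite scale0r addr0 sub0r mulrN mulrC => E; exists s; first exact: ts.
  by rewrite -opprB E opprK.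
Qed.

(** Only derivability along [v] is available, so the homogeneity is taken from the one-variable
    function t -> f(x + t v), whose differential at 0 is linear. This also covers a = 0. *)
Lemma is_derive_scale_dir f x v (a : R) : derivable f x v ->
  is_derive x (a *: v) f (a * 'D_v f x).
Proof.
move=> df; pose F (t : R) := f (x + t *: v).
have dF : is_derive (0 : R) 1 F ('D_v f x).
  by have := @is_derive_line f x v 0; rewrite scale0r addr0; exact.
have dF0 : differentiable F (0 : R).
  by apply/derivable1_diffP; exact: (@ex_derive _ _ _ _ _ _ _ dF).
have E : (fun h : R => h^-1 *: ((f \o shift x) (h *: (a *: v)) - f x)) =
    (fun h : R => h^-1 *: ((F \o shift 0) (h *: a) - F 0)).
  apply/funext => h; rewrite /= /F scale0r !addr0 scalerA.
  by congr (_ *: (f _ - _)); rewrite addrC.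
have D : 'D_a F 0 = a * 'D_v f x.
  have -> : 'D_v f x = 'D_1 F 0 by rewrite (@derive_val _ _ _ _ _ _ _ dF).
  rewrite !deriveE // (_ : 'd F 0 a = 'd F 0 (a *: (1 : R))).
    by rewrite linearZ.
  by congr ('d F 0 _); rewrite [RHS]mulr1.
split; first by rewrite /derivable E; exact: diff_derivable.
by rewrite {1}/derive E -D.
Qed.

Lemma near_segments x v w (P : V -> Prop) : nbhs x P ->
  \forall h \near (0 : R), forall s t, `|s| <= `|h| -> `|t| <= `|h| ->
    P (x + s *: v + t *: w).
Proof.
move=> /nbhs_normP[d d0 Pd]; near=> h => s t sh th; apply: Pd => /=.
rewrite -addrA opprD addrA subrr add0r normrN.
apply: (le_lt_trans (ler_normD _ _)); rewrite !normrZ.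
(* The summand 1 keeps the factor positive when [v] and [w] both vanish, so one can divide by it. *)
apply: (@le_lt_trans _ _ (`|h| * (`|v| + `|w| + 1))).
  rewrite mulrDr mulr1 mulrDr -[X in X <= _]addr0.
  by rewrite !lerD // ler_wpM2r.
rewrite -ltr_pdivlMr ?ltr_wpDl ?addr_ge0//; near: h.
apply/nbhs_normP; exists (d / (`|v| + `|w| + 1)) => /=.
  by rewrite divr_gt0 // ltr_wpDl ?addr_ge0.
by move=> h /=; rewrite sub0r normrN.
Unshelve. all: by end_near. Qed.

(** The increment along v + w is travelled in two legs. The first gives 'D_v; on the second the mean
    value theorem gives 'D_w at a nearby point, which tends to 'D_w at [x] by continuity. Only the
    second direction has to be controlled around [x]. *)
Lemma is_derive_add_dir f x v w : derivable f x v ->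
  (\forall z \near x, derivable f z w) -> {for x, continuous ('D_w f)} ->
  is_derive x (v + w) f ('D_v f x + 'D_w f x).
Proof.
move=> dv dw cw.
have Q : (fun h : R => h^-1 *: (f (x + h *: v + h *: w) - f (x + h *: v))) @ 0^'
    --> 'D_w f x.
  apply/cvgrPdist_lt => e e0.
  have N : nbhs x [set z | derivable f z w /\ `|'D_w f x - 'D_w f z| < e].
    apply: filterI => //; have /cvgrPdist_lt := cw; exact.
  near=> h.
  have h0 : h != 0 by near: h; exact: nbhs_dnbhs_neq.
  have Ph : forall s t, `|s| <= `|h| -> `|t| <= `|h| ->
      derivable f (x + s *: v + t *: w) w /\
      `|'D_w f x - 'D_w f (x + s *: v + t *: w)| < e.
    by near: h; apply: nbhs_dnbhs; exact: near_segments N.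
  have [|s sh ->] := @mvt_line f (x + h *: v) w h.
    by move=> s sh; have [] := Ph h s (lexx _) sh.
  rewrite [_ *: _]mulrA mulVf // mul1r.
  by have [] := Ph h s (lexx _) sh.
have E : (fun h : R => h^-1 *: ((f \o shift x) (h *: (v + w)) - f x)) =
    (fun h : R => h^-1 *: ((f \o shift x) (h *: v) - f x) +
       h^-1 *: (f (x + h *: v + h *: w) - f (x + h *: v))).
  apply/funext => h; rewrite /= -scalerDr; congr (_ *: _).
  rewrite [h *: v + x]addrC [RHS]addrC [RHS]addrA addrNK.
  by congr (f _ - _); rewrite scalerDr addrC addrA.
have C : (fun h : R => h^-1 *: ((f \o shift x) (h *: (v + w)) - f x)) @ 0^'
    --> 'D_v f x + 'D_w f x.
  by rewrite E; apply: cvgD.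
split; first by apply/cvg_ex; exists ('D_v f x + 'D_w f x).
exact: cvg_lim C.
Unshelve. all: by end_near. Qed.

Lemma derivable_shiftE f x v c :
  derivable (fun z => f (z + c)) x v = derivable f (x + c) v.
Proof. by rewrite /derivable /=; under eq_fun do rewrite -addrA. Qed.

Lemma derive_shiftE f x v c : 'D_v (fun z => f (z + c)) x = 'D_v f (x + c).
Proof. by rewrite /derive /=; under eq_fun do rewrite -addrA. Qed.

(** The mean value theorem is applied twice: along [v] to z -> f(z + h w) - f(z), then along [w] to
    'D_v f. *)
Lemma second_difference f x v w (h : R) :
  (forall s t, `|s| <= `|h| -> `|t| <= `|h| ->
     derivable f (x + s *: v + t *: w) v /\
     derivable ('D_v f) (x + s *: v + t *: w) w) ->
  exists s t, [/\ `|s| <= `|h|, `|t| <= `|h| &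
    f (x + h *: v + h *: w) - f (x + h *: v) - (f (x + h *: w) - f x) =
    h * (h * 'D_w ('D_v f) (x + s *: v + t *: w))].
Proof.
move=> H.
have d1 s : `|s| <= `|h| ->
    derivable (fun z => f (z + h *: w)) (x + s *: v) v.
  by move=> sh; rewrite derivable_shiftE; have [] := H s h sh (lexx _).
have d2 s : `|s| <= `|h| -> derivable f (x + s *: v) v.
  by move=> sh; have [] := H s 0 sh; rewrite ?normr0 // scale0r addr0.
have [s sh|s sh] := @mvt_line (fun z => f (z + h *: w) - f z) x v h.
  by apply: derivableB; [exact: d1|exact: d2].
have -> : 'D_v (fun z => f (z + h *: w) - f z) (x + s *: v) =
    'D_v f (x + s *: v + h *: w) - 'D_v f (x + s *: v).
  by rewrite -[X in _ = X - _]derive_shiftE; apply: deriveB; [exact: d1|exact: d2].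
have [|t th ->] := @mvt_line ('D_v f) (x + s *: v) w h.
  by move=> t th; have [] := H s t sh th.
by move=> E; exists s, t; split.
Qed.

(** Schwarz's argument: one second difference equals h^2 times either mixed derivative, each taken
    at some point near [x]. If the two values at [x] differed by e > 0, continuity within e / 2
    would give e < e. *)
Lemma derive_comm f x v w :
  (\forall z \near x, [/\ derivable f z v, derivable f z w,
     derivable ('D_v f) z w & derivable ('D_w f) z v]) ->
  {for x, continuous ('D_w ('D_v f))} -> {for x, continuous ('D_v ('D_w f))} ->
  'D_w ('D_v f) x = 'D_v ('D_w f) x.
Proof.
move=> dn c1 c2; apply/eqP; rewrite -subr_eq0 -normr_eq0; apply/negPn/negP => ne.
set e := `| _ - _ | in ne.
have e0 : 0 < e / 2 by rewrite divr_gt0 // lt_neqAle eq_sym ne normr_ge0.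
pose G := [set z | [/\ derivable f z v, derivable f z w,
     derivable ('D_v f) z w & derivable ('D_w f) z v] /\
    (`|'D_w ('D_v f) x - 'D_w ('D_v f) z| < e / 2 /\
     `|'D_v ('D_w f) x - 'D_v ('D_w f) z| < e / 2)].
have N : nbhs x G.
  apply: filterI => //; apply: filterI.
  - by have /cvgrPdist_lt := c1; exact.
  - by have /cvgrPdist_lt := c2; exact.
have [h [h0 Ph]] : exists h : R, h != 0 /\ forall s t, `|s| <= `|h| ->
    `|t| <= `|h| -> G (x + s *: v + t *: w).
  have nz : \forall h \near (0 : R)^', h != 0 by exact: nbhs_dnbhs_neq.
  have [h [h0 Ph]] := filter_ex (filterI nz (nbhs_dnbhs (near_segments v w N))).
  by exists h.
have [|s [t [sh th E1]]] := @second_difference f x v w h.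
  by move=> s t sh th; have [[]] := Ph s t sh th.
have [|t' [s' [th' sh' E2]]] := @second_difference f x w v h.
  move=> t' s' th' sh'; rewrite (addrAC x (t' *: w) (s' *: v)).
  by have [[]] := Ph s' t' sh' th'.
have E : 'D_w ('D_v f) (x + s *: v + t *: w) =
         'D_v ('D_w f) (x + s' *: v + t' *: w).
  apply: (mulfI h0); apply: (mulfI h0).
  (* The second difference is symmetric in the two directions. *)
  have sw (a b c d : R) : a - b - (c - d) = a - c - (b - d) by ring.
  rewrite (addrAC x (s' *: v) (t' *: w)) -[LHS]E1 -[RHS]E2.
  by rewrite (addrAC x (h *: w) (h *: v)); exact: sw.
have [_ [b1 _]] := Ph s t sh th.
have [_ [_ b2]] := Ph s' t' sh' th'.
have tri (a b c d : R) : c = d -> `|a - c| < e / 2 -> `|b - d| < e / 2 ->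
    `|a - b| < e.
  move=> -> ac bd; rewrite [X in _ < X](splitr e).
  apply: le_lt_trans (ltrD ac bd); rewrite (distrC b).
  by apply: le_trans (ler_normD _ _); rewrite addrA addrNK.
have : e < e := tri _ _ _ _ E b1 b2.
by rewrite ltxx.
Qed.

End DirectionalDerivatives.

Section SmoothDirectional.
Context {R : realType} {n : nat}.
Implicit Types (f g : 'rV[R]_n -> R) (U : set 'rV[R]_n) (x v : 'rV[R]_n).

Lemma partial_comm U f x i j : open U -> smooth_on U f -> U x ->
  partial i (partial j f) x = partial j (partial i f) x.
Proof.
move=> oU sf Ux; apply: derive_comm.
- apply: (@filterS _ (nbhs x) _ U); last exact: open_nbhs_nbhs.
  move=> z Uz; split.
  + exact: smooth_on_derivable sf Uz.
  + exact: smooth_on_derivable sf Uz.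
  + exact: smooth_on_derivable (smooth_on_partial j sf) Uz.
  + exact: smooth_on_derivable (smooth_on_partial i sf) Uz.
- exact: smooth_on_continuous (smooth_on_partial i (smooth_on_partial j sf)) Ux.
- exact: smooth_on_continuous (smooth_on_partial j (smooth_on_partial i sf)) Ux.
Qed.

(** The direction is built up one axis at a time. The new axis is the second summand in
    [is_derive_add_dir], because its derivative is the one known to be continuous; hence the swaps
    of summands. *)
Lemma is_derive_partials U f x v : open U -> smooth_on U f -> U x ->
  is_derive x v f (\sum_k v 0 k * partial k f x).
Proof.
move=> oU sf Ux; rewrite {1}(row_sum_delta v).
elim: (index_enum _) => [|k r IH]; first by rewrite !big_nil; exact: is_derive0.
have D z : U z -> is_derive z (v 0 k *: delta_mx 0 k) f (v 0 k * partial k f z).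
  by move=> Uz; apply: is_derive_scale_dir; exact: smooth_on_derivable sf Uz.
rewrite !big_cons addrC [X in is_derive _ _ _ X]addrC.
rewrite -(@derive_val _ _ _ _ _ _ _ (D x Ux)) -(@derive_val _ _ _ _ _ _ _ IH).
apply: is_derive_add_dir.
- exact: (@ex_derive _ _ _ _ _ _ _ IH).
- apply: (@filterS _ (nbhs x) _ U); last exact: open_nbhs_nbhs.
  by move=> z Uz; exact: (@ex_derive _ _ _ _ _ _ _ (D z Uz)).
- apply: (@eq_on_continuous _ _ U (fun z => v 0 k * partial k f z)) => //.
    by move=> z Uz; rewrite (@derive_val _ _ _ _ _ _ _ (D z Uz)).
  apply: smooth_on_continuous Ux; apply: smooth_onZ => //.
  exact: smooth_on_partial.
Qed.

Lemma slit_open : open (slit : set 'rV[R]_n).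
Proof.
rewrite (_ : slit = ~` [set 0]).
  apply: closed_openC.
  exact: (@accessible_closed_set1 _ (@hausdorff_accessible _ (@norm_hausdorff _ _))).
by apply/seteqP; split => y /= /eqP.
Qed.

(** An arbitrary scaling factor [p] covers the degrees 2, 1 and 0 at once. The chain rule for y -> l
    y costs one factor of l. *)
Lemma partial_homog (p : R -> R) f i :
  (forall (y : 'rV[R]_n) (l : R), y != 0 -> 0 < l -> f (l *: y) = p l * f y) ->
  (forall y : 'rV[R]_n, y != 0 -> derivable f y (delta_mx 0 i)) ->
  forall (y : 'rV[R]_n) (l : R), y != 0 -> 0 < l ->
    partial i f (l *: y) = l^-1 * p l * partial i f y.
Proof.
move=> hf df y l y0 l0.
have ly0 : l *: y != 0 by rewrite scaler_eq0 negb_or y0 gt_eqF.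
apply: (mulfI (lt0r_neq0 l0)); rewrite !mulrA divff ?gt_eqF // mul1r.
have <- : 'D_(l *: delta_mx 0 i) f (l *: y) = l * partial i f (l *: y).
  exact: (@derive_val _ _ _ _ _ _ _ (is_derive_scale_dir l (df _ ly0))).
rewrite -partialZ; last exact: df.
transitivity (partial i (fun z => f (l *: z)) y).
  rewrite /partial /derive; congr (lim (_ @ 0^')); apply/funext => h /=.
  by congr (_ *: (f _ - _)); rewrite scalerDr !scalerA [l * h]mulrC.
by apply: (eq_on_partial _ slit_open) => // z z0; exact: hf.
Qed.

(** The scaling relation is differentiated at l = 1, where its validity for positive l is enough.
    The degree appears as d = p'(1), which also allows p(l) = 1/l. *)
Lemma euler_homog (p : R -> R) (d : R) f y : smooth_on slit f -> y != 0 ->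
  is_derive (1 : R) 1 p d -> (forall l : R, 0 < l -> f (l *: y) = p l * f y) ->
  \sum_k y 0 k * partial k f y = d * f y.
Proof.
move=> sf y0 dp hf.
rewrite -(@derive_val _ _ _ _ _ _ _ (is_derive_partials y slit_open sf y0)).
transitivity ('D_1 (fun t : R => f (t *: y)) 1).
  rewrite /derive; congr (lim (_ @ 0^')); apply/funext => h /=.
  by rewrite scalerDl scale1r [h *: 1]mulr1.
transitivity ('D_1 (fun t : R => p t * f y) 1).
  apply: near_eq_derive; near=> t; apply: hf; near: t.
  exact: lt_nbhsr.
have E := @is_deriveM _ _ p (cst (f y)) (1 : R) 1 _ _ dp (is_derive_cst _ _ _).
rewrite (@derive_val _ _ _ _ _ _ _ E) scaler0 add0r.
exact: mulrC.
Unshelve. all: by end_near. Qed.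

Lemma partial2M U f g x i j : open U -> smooth_on U f -> smooth_on U g -> U x ->
  partial i (partial j (fun y => f y * g y)) x =
  f x * partial i (partial j g) x + partial i f x * partial j g x +
  partial j f x * partial i g x + g x * partial i (partial j f) x.
Proof.
move=> oU sf sg Ux.
have df k z : U z -> derivable f z (delta_mx 0 k) := smooth_on_derivable sf.
have dg k z : U z -> derivable g z (delta_mx 0 k) := smooth_on_derivable sg.
have djf := smooth_on_derivable (i := i) (smooth_on_partial j sf) Ux.
have djg := smooth_on_derivable (i := i) (smooth_on_partial j sg) Ux.
have E z : U z -> partial j (fun y => f y * g y) z =
    f z * partial j g z + g z * partial j f z.
  by move=> Uz; exact: partialM (df _ _ Uz) (dg _ _ Uz).
rewrite (eq_on_partial _ oU E Ux).
rewrite (partialD (derivableM (df _ _ Ux) djg) (derivableM (dg _ _ Ux) djf)).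
rewrite (partialM (df _ _ Ux) djg) (partialM (dg _ _ Ux) djf).
have ac (p q s t u v : R) : p + q * s + (t + u * v) = p + s * q + u * v + t by ring.
exact: ac.
Qed.

Lemma partial2DZ U f g (c : R) x i j : open U -> smooth_on U f -> smooth_on U g ->
  U x -> partial i (partial j (fun y => f y + c * g y)) x =
  partial i (partial j f) x + c * partial i (partial j g) x.
Proof.
move=> oU sf sg Ux.
have D (f1 g1 : 'rV[R]_n -> R) k z : smooth_on U f1 -> smooth_on U g1 -> U z ->
    partial k (fun y => f1 y + c * g1 y) z = partial k f1 z + c * partial k g1 z.
  move=> sf1 sg1 Uz; have dg := smooth_on_derivable (i := k) sg1 Uz.
  rewrite -(partialZ c dg); apply: partialD.
    exact: smooth_on_derivable sf1 Uz.
  exact: derivableM (derivable_cst _ _ _) dg.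
rewrite (eq_on_partial _ oU (fun z => D f g j z sf sg) Ux).
by apply: D Ux; exact: smooth_on_partial.
Qed.

End SmoothDirectional.

(** * Finsler tensors at a fixed base point *)

Section MatrixDerivative.
Context {R : realType} {n m : nat}.

(** Obtained by differentiating A A^-1 = 1. *)
Lemma partial_invmx U (A : 'rV[R]_n -> 'M[R]_m) k y : open U ->
  (forall z, U z -> A z \in unitmx) ->
  (forall i j, smooth_on U (fun z => A z i j)) -> U y ->
  \matrix_(i, j) partial k (fun z => invmx (A z) i j) y =
  - (invmx (A y) *m (\matrix_(i, j) partial k (fun z => A z i j) y)
       *m invmx (A y)).
Proof.
move=> oU uA sA Uy; set dV := LHS; set dA := (X in _ *m X *m _).
have E : A y *m dV + dA *m invmx (A y) = 0.
  apply/matrixP => i j; rewrite !mxE -big_split /=.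
  transitivity (partial k (fun z => \sum_l A z i l * invmx (A z) l j) y).
    rewrite partial_big => [|l _]; last first.
      by apply: derivableM; apply: smooth_on_derivable Uy => //;
        exact: smooth_on_invmx.
    apply: eq_bigr => l _; rewrite partialM; last 2 first.
    - exact: smooth_on_derivable Uy.
    - exact: smooth_on_derivable (smooth_on_invmx oU uA sA _ _) Uy.
    by rewrite !mxE [X in _ + X]mulrC.
  rewrite -[RHS](partial_cst ((1%:M : 'M[R]_m) i j) y k).
  by apply: (eq_on_partial _ oU _ Uy) => z Uz; rewrite -(mulmxV (uA z Uz)) mxE.
apply: (can_inj (mulKmx (uA y Uy))).
rewrite mulmxN !mulmxA mulmxV ?uA // mul1mx.
by apply/eqP; rewrite -addr_eq0 E.
Qed.

End MatrixDerivative.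

Section LinearForm.
Context {R : realType} {n : nat}.
Implicit Types (c : 'I_n -> R) (y : 'rV[R]_n).

(** Used for f_k y^k and f_b v^b, the parts of the divergence that the fibre Hessian kills. *)
Definition linear_form c y : R := \sum_k c k * y 0 k.

Lemma linear_form_smooth U c : open U -> smooth_on U (linear_form c).
Proof.
move=> oU; apply: smooth_on_sum => // k _; apply: smooth_onZ => //.
exact: smooth_on_coord.
Qed.

Lemma partial_linear_form c j : partial j (linear_form c) = fun=> c j.
Proof.
apply/funext => y.
have dy k : derivable (fun y : 'rV[R]_n => y 0 k) y (delta_mx 0 j).
  exact: (@ex_derive _ _ _ _ _ _ _ (is_derive_coord k y _)).
rewrite /linear_form partial_big => [|k _]; last first.
  exact: derivableM (derivable_cst _ _ _) (dy k).
transitivity (\sum_k c k * (j == k)%:R).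
  by apply: eq_bigr => k _; rewrite partialZ // partial_coord.
rewrite (bigD1 j) //= eqxx mulr1 big1 ?addr0 // => k kj.
by rewrite eq_sym (negPf kj) mulr0.
Qed.

Lemma partial2_linear_form c i j y : partial i (partial j (linear_form c)) y = 0.
Proof. by rewrite partial_linear_form partial_cst. Qed.

End LinearForm.

Section FibreMetric.
Context {R : realType} {n : nat}.
Variables (F : 'rV[R]_n -> 'rV[R]_n -> R) (x : 'rV[R]_n).
Implicit Types (y : 'rV[R]_n) (l : R).

Local Notation L := (energy F x).
Local Notation g y := (fund F x y).
Local Notation h y := (fund_inv F x y).

Hypothesis L_smooth : smooth_on slit L.
Hypothesis L_homog : forall y l, 0 < l -> L (l *: y) = l ^+ 2 * L y.
Hypothesis g_posdef : forall y w : 'rV[R]_n, y != 0 -> w != 0 ->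
  0 < \sum_i \sum_j g y i j * w 0 i * w 0 j.

Lemma fundE y i j : g y i j = 2^-1 * partial j (partial i L) y.
Proof. by rewrite mxE. Qed.

Lemma fund_sym y i j : y != 0 -> g y i j = g y j i.
Proof.
move=> y0; rewrite [LHS]fundE [RHS]fundE; apply: (congr1 (fun t => _ * t)).
exact: partial_comm slit_open L_smooth y0.
Qed.

Lemma fund_tr y : y != 0 -> (g y)^T = g y.
Proof. by move=> y0; apply/matrixP => i j; rewrite mxE fund_sym. Qed.

(** A nonzero kernel vector would annihilate the positive definite form. *)
Lemma fund_unit y : y != 0 -> g y \in unitmx.
Proof.
move=> y0; rewrite -row_free_unit -kermx_eq0; apply/negPn/negP => /rowV0Pn[w].
move=> /sub_kermxP wg w0; have := g_posdef y0 w0.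
suff -> : \sum_i \sum_j g y i j * w 0 i * w 0 j = 0 by rewrite ltxx.
rewrite exchange_big /= big1 // => j _.
have /matrixP/(_ 0 j) := wg; rewrite !mxE => E.
rewrite -mulr_suml; under eq_bigr do rewrite mulrC.
by rewrite E mul0r.
Qed.

Lemma fund_smooth i j : smooth_on slit (fun y => g y i j).
Proof.
under eq_fun do rewrite fundE.
apply: smooth_onZ slit_open _; exact/smooth_on_partial/smooth_on_partial.
Qed.

Lemma fund_inv_smooth i j : smooth_on slit (fun y => h y i j).
Proof. apply: smooth_on_invmx slit_open fund_unit fund_smooth _ _. Qed.

Lemma fund_inv_sym y i j : y != 0 -> h y i j = h y j i.
Proof.
move=> y0; have E : (h y)^T = h y by rewrite /fund_inv trmx_inv fund_tr.
by rewrite -{1}E mxE.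
Qed.

Lemma partial_energy_homog i y (l : R) : y != 0 -> 0 < l ->
  partial i L (l *: y) = l * partial i L y.
Proof.
move=> y0 l0; transitivity (l^-1 * l ^+ 2 * partial i L y).
  apply: (@partial_homog _ _ (fun l => l ^+ 2)) => // [z m _|z z0].
    exact: L_homog.
  exact: smooth_on_derivable L_smooth z0.
by rewrite expr2 mulKf ?gt_eqF.
Qed.

Lemma fund_homog i j y (l : R) : y != 0 -> 0 < l -> g (l *: y) i j = g y i j.
Proof.
move=> y0 l0; rewrite [LHS]fundE [RHS]fundE; apply: (congr1 (fun t => _ * t)).
transitivity (l^-1 * l * partial j (partial i L) y).
  apply: (@partial_homog _ _ id) => // [z m z0 m0|z z0].
    exact: partial_energy_homog.
  exact: smooth_on_derivable (smooth_on_partial i L_smooth) z0.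
by rewrite mulVf ?mul1r ?gt_eqF.
Qed.

(** Euler's theorem for the first derivatives of F^2, which have degree 1. *)
Lemma lowerE y i : y != 0 -> lower F i x y = 2^-1 * partial i L y.
Proof.
move=> y0; transitivity (2^-1 * \sum_j y 0 j * partial j (partial i L) y).
  rewrite mulr_sumr; apply: eq_bigr => j _.
  by rewrite fundE -mulrA [X in _ * X]mulrC.
apply: (congr1 (fun t => _ * t)); rewrite -[RHS]mul1r.
apply: (@euler_homog _ _ id) => //.
- exact: smooth_on_partial.
- by move=> l l0; exact: partial_energy_homog.
Qed.

Lemma sum_lower y : y != 0 -> \sum_i lower F i x y * y 0 i = L y.
Proof.
move=> y0; transitivity (2^-1 * \sum_i y 0 i * partial i L y).
  rewrite mulr_sumr; apply: eq_bigr => i _.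
  by rewrite lowerE // -mulrA [X in _ * X]mulrC.
have -> : \sum_i y 0 i * partial i L y = 2 * L y.
  apply: (@euler_homog _ _ (fun l => l ^+ 2)) => // [|l l0].
    apply: (@is_derive_eq _ _ _ (id ^+ 2 : R -> R)).
    by rewrite /= expr1 mulr1 [_ *: 1]mulr1.
  exact: L_homog.
by rewrite mulKf // pnatr_eq0.
Qed.

Lemma energy_gt0 y : y != 0 -> 0 < L y.
Proof.
move=> y0; have := g_posdef y0 y0; rewrite -sum_lower //.
suff -> : \sum_i \sum_j g y i j * y 0 i * y 0 j = \sum_i lower F i x y * y 0 i by [].
apply: eq_bigr => i _; rewrite /lower mulr_suml.
by apply: eq_bigr => j _; rewrite mulrAC.
Qed.

(** As a multiple of a third derivative of F^2, the Cartan tensor is totally symmetric. *)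
Lemma cartanE y i j k : y != 0 ->
  cartan F i j k x y = 4^-1 * partial k (partial j (partial i L)) y.
Proof.
move=> y0; rewrite /cartan /pdy.
under eq_fun do rewrite fundE.
rewrite partialZ; last first.
  exact: smooth_on_derivable (smooth_on_partial j (smooth_on_partial i L_smooth)) y0.
by rewrite mulrA -invfM -natrM.
Qed.

Lemma cartan_sym12 y i j k : y != 0 -> cartan F i j k x y = cartan F j i k x y.
Proof.
move=> y0; rewrite [LHS](cartanE _ _ _ y0) [RHS](cartanE _ _ _ y0).
apply: (congr1 (fun t => _ * t)).
apply: (eq_on_partial _ slit_open _ y0) => z z0.
exact: partial_comm slit_open L_smooth z0.
Qed.

Lemma cartan_sym23 y i j k : y != 0 -> cartan F i j k x y = cartan F i k j x y.
Proof.
move=> y0; rewrite [LHS](cartanE _ _ _ y0) [RHS](cartanE _ _ _ y0).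
apply: (congr1 (fun t => _ * t)).
exact: partial_comm slit_open (smooth_on_partial i L_smooth) y0.
Qed.

Lemma cartan_smooth i j k : smooth_on slit (cartan F i j k x).
Proof.
apply: smooth_onZ slit_open _; apply: smooth_on_partial; exact: fund_smooth.
Qed.

(** By total symmetry y may be contracted with the differentiated slot; the fundamental tensor has
    degree 0, so Euler's theorem gives zero. *)
Lemma sum_cartan y j k : y != 0 -> \sum_i y 0 i * cartan F i j k x y = 0.
Proof.
move=> y0.
transitivity (2^-1 * \sum_i y 0 i * partial i (fun z => g z j k) y).
  rewrite mulr_sumr; apply: eq_bigr => i _.
  by rewrite (cartan_sym12 _ _ _ y0) (cartan_sym23 _ _ _ y0) /cartan [LHS]mulrCA.
have -> : \sum_i y 0 i * partial i (fun z => g z j k) y = 0 * g y j k.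
  apply: (@euler_homog _ _ (cst 1)) => // [|l l0].
    exact: fund_smooth.
  by rewrite mul1r; exact: fund_homog.
by rewrite mul0r mulr0.
Qed.

Lemma cartan2_smooth i j k : smooth_on slit (cartan2 F i j k x).
Proof.
apply: smooth_on_sum slit_open _ => m _; apply: smooth_on_sum slit_open _ => l _.
apply: smooth_onM slit_open _ _; last exact: cartan_smooth.
apply: smooth_onM slit_open _ _; exact: fund_inv_smooth.
Qed.

Lemma mean_cartan_smooth i : smooth_on slit (mean_cartan F i x).
Proof. apply: smooth_on_sum slit_open _ => m _; exact: cartan2_smooth. Qed.

Lemma lower_smooth i : smooth_on slit (lower F i x).
Proof.
apply: smooth_on_sum slit_open _ => m _; apply: smooth_onM slit_open _ _.
  exact: fund_smooth.
exact: smooth_on_coord.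
Qed.

Lemma partial_lower y i j : y != 0 -> partial j (lower F i x) y = g y i j.
Proof.
move=> y0; transitivity (partial j (fun z => 2^-1 * partial i L z) y).
  by apply: (eq_on_partial _ slit_open _ y0) => z z0; exact: lowerE.
rewrite [RHS]fundE; apply: partialZ.
exact: smooth_on_derivable (smooth_on_partial i L_smooth) y0.
Qed.

Lemma sum_lower_fund_inv y m : y != 0 -> \sum_i lower F i x y * h y i m = y 0 m.
Proof.
move=> y0; transitivity ((y *m (g y)^T *m h y) 0 m).
  rewrite mxE; apply: eq_bigr => i _; congr (_ * _).
  by rewrite mxE; apply: eq_bigr => j _; rewrite [X in _ = _ * X]mxE mulrC.
by rewrite fund_tr // mulmxK // fund_unit.
Qed.

Lemma sum_fund_inv_lower y m : y != 0 -> \sum_i h y m i * lower F i x y = y 0 m.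
Proof.
move=> y0; rewrite -[RHS]sum_lower_fund_inv //; apply: eq_bigr => i _.
by rewrite mulrC fund_inv_sym.
Qed.

(** Contraction with y_i undoes the raising, y_i g^{im} = y^m, and y^m C_{mla} = 0. *)
Lemma cartan2_lower y nu a : y != 0 ->
  \sum_i cartan2 F i nu a x y * lower F i x y = 0.
Proof.
move=> y0; rewrite /cartan2.
transitivity (\sum_l h y nu l * \sum_m y 0 m * cartan F m l a x y); last first.
  by rewrite big1 // => l _; rewrite sum_cartan // mulr0.
transitivity (\sum_l \sum_m \sum_i
    (lower F i x y * h y i m) * (h y nu l * cartan F m l a x y)).
  under eq_bigr do rewrite mulr_suml.
  rewrite exchange_big /= [RHS]exchange_big /=; apply: eq_bigr => m _.
  rewrite [RHS]exchange_big /=; apply: eq_bigr => i _; rewrite mulr_suml.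
  apply: eq_bigr => l _.
  by rewrite mulrC !mulrA.
apply: eq_bigr => l _; rewrite mulr_sumr; apply: eq_bigr => m _.
by rewrite -mulr_suml sum_lower_fund_inv // mulrCA.
Qed.

Lemma cartan2_fund y nu a b : y != 0 ->
  \sum_i cartan2 F i nu a x y * g y i b = cartan1 F nu a b x y.
Proof.
move=> y0; rewrite /cartan2 /cartan1.
transitivity (\sum_l \sum_m (\sum_i h y m i * g y i b) *
    (h y nu l * cartan F m l a x y)).
  under eq_bigr do rewrite mulr_suml.
  rewrite exchange_big /= [RHS]exchange_big /=; apply: eq_bigr => m _.
  under eq_bigr do rewrite mulr_suml.
  rewrite exchange_big /=; apply: eq_bigr => l _.
  rewrite mulr_suml; apply: eq_bigr => i _.
  have ac (p q r s : R) : p * q * r * s = p * s * (q * r) by ring.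
  by rewrite (@fund_inv_sym y i m y0); exact: ac.
have K m : \sum_i h y m i * g y i b = (m == b)%:R.
  have := mulVmx (fund_unit y0) => /matrixP/(_ m b).
  by rewrite [LHS]mxE [RHS]mxE.
apply: eq_bigr => l _; under eq_bigr do rewrite K.
rewrite (bigD1 b) //= eqxx mul1r big1 => [|m /negPf ->]; last by rewrite mul0r.
by rewrite addr0 (cartan_sym12 _ _ _ y0) (cartan_sym23 _ _ _ y0).
Qed.

(* Differentiate C^{gamma nu}_alpha v_gamma = 0. *)
Lemma partial_cartan2_lower y nu a b : y != 0 ->
  \sum_i pdy b (cartan2 F i nu a) x y * lower F i x y = - cartan1 F nu a b x y.
Proof.
move=> y0; apply/eqP; rewrite -addr_eq0 -cartan2_fund // -big_split /=; apply/eqP.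
transitivity (partial b (fun z => \sum_i cartan2 F i nu a x z * lower F i x z) y).
  rewrite partial_big => [|i _]; last first.
    by apply: derivableM; apply: smooth_on_derivable y0;
      [exact: cartan2_smooth|exact: lower_smooth].
  apply: eq_bigr => i _; rewrite partialM; last 2 first.
  - exact: smooth_on_derivable (cartan2_smooth _ _ _) y0.
  - exact: smooth_on_derivable (lower_smooth _) y0.
  by rewrite partial_lower // addrC [X in _ + X]mulrC.
rewrite -[RHS](partial_cst 0 y b).
by apply: (eq_on_partial _ slit_open _ y0) => z z0; exact: cartan2_lower.
Qed.

(** The derivative of the inverse is -g^{im} (d_i g_{mk}) g^{kl}, and d_i g_{mk} = 2 C_{mki}
    accounts for the factor 2. *)
Lemma divergence_fund_inv y (l : 'I_n) : y != 0 ->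
  \sum_i partial i (fun z => h z i l) y = - (2 * mean_cartan F l x y).
Proof.
move=> y0; rewrite /mean_cartan mulr_sumr -sumrN; apply: eq_bigr => i _.
have := partial_invmx i slit_open fund_unit fund_smooth y0.
move=> /matrixP/(_ i l); rewrite !mxE => ->.
congr (- _); rewrite /cartan2 exchange_big mulr_sumr; apply: eq_bigr => m _.
rewrite mxE mulr_suml mulr_sumr; apply: eq_bigr => k _.
rewrite mxE /cartan /pdy -/(fund_inv _ _ _) (@fund_inv_sym y l m) //.
by field.
Qed.

Lemma divergence_fund_inv_form y (d : 'I_n -> R) : y != 0 ->
  \sum_i partial i (fun z => \sum_l d l * h z i l) y =
  - (2 * \sum_l d l * mean_cartan F l x y).
Proof.
move=> y0; transitivity (\sum_i \sum_l d l * partial i (fun z => h z i l) y).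
  have dh i (l : 'I_n) : derivable (fun z => h z i l) y (delta_mx 0 i).
    exact: smooth_on_derivable (fund_inv_smooth _ _) y0.
  apply: eq_bigr => i _; rewrite partial_big => [|l _]; last first.
    exact: derivableM (derivable_cst _ _ _) (dh i l).
  by apply: eq_bigr => l _; exact: partialZ.
rewrite exchange_big mulr_sumr -sumrN; apply: eq_bigr => l _.
by rewrite -mulr_sumr (divergence_fund_inv _ y0) mulrN mulrCA.
Qed.

(** Since d_i F^2 = 2 y_i, raising the index gives back y^l. *)
Lemma sum_fund_inv_form y (d : 'I_n -> R) : y != 0 ->
  \sum_i (\sum_l d l * h y i l) * partial i L y = 2 * linear_form d y.
Proof.
move=> y0; under eq_bigr do rewrite mulr_suml.
rewrite exchange_big mulr_sumr; apply: eq_bigr => l _.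
rewrite -(sum_lower_fund_inv l y0) !mulr_sumr; apply: eq_bigr => i _.
rewrite (lowerE _ y0).
have ac (p q s : R) : p * q * s = 2 * (p * (2^-1 * s * q)) by field.
exact: ac.
Qed.

Lemma cartan_homog i j k y (l : R) : y != 0 -> 0 < l ->
  cartan F i j k x (l *: y) = l^-1 * cartan F i j k x y.
Proof.
move=> y0 l0; rewrite /cartan /pdy [RHS]mulrCA.
apply: (congr1 (fun t => _ * t)); rewrite -[l^-1]mulr1.
apply: (@partial_homog _ _ (cst 1)) => // [z m z0 m0|z z0].
  by rewrite mul1r; exact: fund_homog.
exact: smooth_on_derivable (fund_smooth _ _) z0.
Qed.

Lemma fund_inv_homog y (l : R) : y != 0 -> 0 < l -> h (l *: y) = h y.
Proof.
move=> y0 l0; apply: (congr1 invmx); apply/matrixP => i j; exact: fund_homog.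
Qed.

Lemma mean_cartan_homog i y (l : R) : y != 0 -> 0 < l ->
  mean_cartan F i x (l *: y) = l^-1 * mean_cartan F i x y.
Proof.
move=> y0 l0; rewrite /mean_cartan /cartan2 mulr_sumr; apply: eq_bigr => k _.
rewrite mulr_sumr; apply: eq_bigr => m _; rewrite mulr_sumr; apply: eq_bigr => p _.
by rewrite (fund_inv_homog y0 l0) (cartan_homog _ _ _ y0 l0) [LHS]mulrCA.
Qed.

Lemma euler_mean_cartan i y : y != 0 ->
  \sum_k y 0 k * partial k (mean_cartan F i x) y = - mean_cartan F i x y.
Proof.
move=> y0; rewrite -mulN1r; apply: (@euler_homog _ _ (fun l => l^-1)) => //.
- exact: mean_cartan_smooth.
- have d1 : derivable (id : R -> R) 1 1 by exact: derivable_id.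
  have n1 : (id (1 : R)) != 0 by exact: oner_neq0.
  split; first exact: (derivableV n1 d1).
  by rewrite (deriveV n1 d1) derive_id expr1n invr1 [_ *: _]mulr1.
- by move=> l l0; exact: mean_cartan_homog.
Qed.

Lemma mean_cartan_form_smooth (d : 'I_n -> R) :
  smooth_on slit (fun z => \sum_k d k * mean_cartan F k x z).
Proof.
apply: smooth_on_sum slit_open _ => k _; apply: smooth_onZ slit_open _.
exact: mean_cartan_smooth.
Qed.

Lemma partial_mean_cartan_form y (d : 'I_n -> R) a : y != 0 ->
  partial a (fun z => \sum_k d k * mean_cartan F k x z) y =
  \sum_k d k * partial a (mean_cartan F k x) y.
Proof.
move=> y0.
have dI k := smooth_on_derivable (i := a) (mean_cartan_smooth k) y0.
rewrite partial_big => [|k _].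
  by apply: eq_bigr => k _; exact: partialZ.
exact: derivableM (derivable_cst _ _ _) (dI k).
Qed.

Lemma partial2_mean_cartan_form y (d : 'I_n -> R) a b : y != 0 ->
  partial a (partial b (fun z => \sum_k d k * mean_cartan F k x z)) y =
  \sum_k d k * partial a (partial b (mean_cartan F k x)) y.
Proof.
move=> y0.
rewrite (eq_on_partial _ slit_open (fun z z0 => partial_mean_cartan_form d b z0) y0).
have dI k := smooth_on_derivable (i := a)
  (smooth_on_partial b (mean_cartan_smooth k)) y0.
rewrite partial_big => [|k _].
  by apply: eq_bigr => k _; exact: partialZ.
exact: derivableM (derivable_cst _ _ _) (dI k).
Qed.

(** Recovers the contraction I^k d_k from its fibre gradient, so that a vanishing gradient forces
    the contraction itself to vanish. *)
Lemma euler_mean_cartan_form y (d : 'I_n -> R) : y != 0 ->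
  \sum_j y 0 j * partial j (fun z => \sum_k d k * mean_cartan F k x z) y =
  - \sum_k d k * mean_cartan F k x y.
Proof.
move=> y0; under eq_bigr do rewrite (partial_mean_cartan_form _ _ y0) mulr_sumr.
rewrite exchange_big -sumrN; apply: eq_bigr => k _.
rewrite -mulrN -(euler_mean_cartan k y0) mulr_sumr; apply: eq_bigr => j _.
by rewrite mulrCA.
Qed.

(** The right-hand side of the theorem is, up to the factor -s/2, the fibre Hessian of (I^nu d_nu)
    F^2. In the Leibniz expansion d_a F^2 = 2 v_a and d_a d_b F^2 = 2 g_ab, so the halves disappear
    from every term except the one where I^nu is differentiated twice. The two Cartan terms cancel
    by [partial_cartan2_lower]. *)
Lemma hessian_mean_cartan_form_energy y (d : 'I_n -> R) (s : R) a b : y != 0 ->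
  - (2^-1 * s * (\sum_nu pdy b (pdy a (mean_cartan F nu)) x y * d nu) * F x y ^+ 2)
  - s * \sum_nu d nu *
      (\sum_i pdy b (cartan2 F i nu a) x y * lower F i x y
       + pdy a (mean_cartan F nu) x y * lower F b x y
       + pdy b (mean_cartan F nu) x y * lower F a x y
       + cartan1 F nu a b x y
       + mean_cartan F nu x y * fund F x y a b) =
  - (2^-1 * (s * partial a (partial b
       (fun z => (\sum_k d k * mean_cartan F k x z) * L z)) y)).
Proof.
move=> y0; rewrite (partial2M a b slit_open (mean_cartan_form_smooth d) L_smooth y0).
rewrite !(partial_mean_cartan_form _ _ y0) (partial2_mean_cartan_form _ _ _ y0).
rewrite -[F x y ^+ 2]/(L y).
(* The formula differentiates I^nu by a first and then by b, the Hessian in the opposite order. *)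
have P k : pdy b (pdy a (mean_cartan F k)) x y =
    partial a (partial b (mean_cartan F k x)) y.
  exact: (partial_comm b a slit_open (mean_cartan_smooth k) y0).
under eq_bigr do rewrite P.
under [X in _ - _ * X]eq_bigr do rewrite (partial_cartan2_lower _ _ _ y0)
  (lowerE a y0) (lowerE b y0) [fund F x y a b]fund_sym // fundE.
have ac (c0 ca cb cab t q : 'I_n -> R) (l la lb lab : R) :
  - (2^-1 * s * (\sum_k cab k * q k) * l) -
    s * (\sum_k q k * (- t k + ca k * (2^-1 * lb) + cb k * (2^-1 * la) + t k +
      c0 k * (2^-1 * lab))) =
  - (2^-1 * (s * ((\sum_k q k * c0 k) * lab + (\sum_k q k * ca k) * lb +
      (\sum_k q k * cb k) * la + l * (\sum_k q k * cab k)))).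
  have -> : \sum_k cab k * q k = \sum_k q k * cab k.
    by apply: eq_bigr => k _; rewrite mulrC.
  have -> : \sum_k q k * (- t k + ca k * (2^-1 * lb) + cb k * (2^-1 * la) + t k +
      c0 k * (2^-1 * lab)) = 2^-1 * (lb * (\sum_k q k * ca k) +
      la * (\sum_k q k * cb k) + lab * (\sum_k q k * c0 k)).
    rewrite !mulr_sumr -!big_split /= mulr_sumr.
    by apply: eq_bigr => k _; ring.
  by ring.
exact: ac.
Qed.

Hypothesis dxL_smooth : forall l : 'I_n, smooth_on slit (pdx l (energy F) x).
Hypothesis dxyL_smooth : forall k l : 'I_n, smooth_on slit (pdx k (pdy l (energy F)) x).

Lemma spray_smooth i : smooth_on slit (spray F i x).
Proof.
apply: smooth_onZ slit_open _; apply: smooth_on_sum slit_open _ => l _.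
apply: smooth_onM slit_open _ _; first exact: fund_inv_smooth.
apply: smooth_onB slit_open _ _; last exact: dxL_smooth.
apply: smooth_on_sum slit_open _ => k _; apply: smooth_onM slit_open _ _.
  exact: dxyL_smooth.
exact: smooth_on_coord.
Qed.

End FibreMetric.

Section SprayDivergence.
Context {R : realType} {n : nat}.

Definition spray_div (F : 'rV[R]_n -> 'rV[R]_n -> R) (x y : 'rV[R]_n) : R :=
  \sum_m partial m (spray F m x) y.

Lemma spray_div_smooth U F x : open U ->
  (forall i, smooth_on U (spray F i x)) -> smooth_on U (spray_div F x).
Proof.
by move=> oU sG; apply: smooth_on_sum => // m _; exact: smooth_on_partial.
Qed.

(** In B^m_{jkm} the contracted derivative is the innermost one, so by linearity the trace passes
    through the other two. *)
Lemma mean_berwaldE U F x y j k : open U ->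
  (forall i, smooth_on U (spray F i x)) -> U y ->
  mean_berwald F j k x y = 2^-1 * partial j (partial k (spray_div F x)) y.
Proof.
move=> oU sG Uy; rewrite /mean_berwald /berwald /pdy; congr (_ * _).
rewrite -partial_big => [|m _]; last first.
  apply: smooth_on_derivable Uy.
  exact: (smooth_on_partial k (smooth_on_partial m (sG m))).
apply: (eq_on_partial _ oU _ Uy) => z Uz.
rewrite [RHS]partial_big => [//|m _]; apply: smooth_on_derivable Uz.
exact: smooth_on_partial.
Qed.

End SprayDivergence.

(** * Functions on products *)

Section Slices.
Context {R : realType} {n1 n2 : nat}.
Implicit Types (f : 'rV[R]_(n1 + n2) -> R) (x : 'rV[R]_n1) (y : 'rV[R]_n2).

Lemma shift_delta_l x y k (t : R) : row_mx (t *: delta_mx 0 k + x) y =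
  t *: delta_mx 0 (lshift n2 k) + row_mx x y.
Proof.
apply/rowP => j; rewrite -[j]splitK; case: (fintype.split j) => i /=.
- by rewrite row_mxEl [LHS]mxE [RHS]mxE row_mxEl !mxE (inj_eq (@lshift_inj _ _)).
- by rewrite row_mxEr [RHS]mxE row_mxEr !mxE eq_rlshift andbF mulr0 add0r.
Qed.

Lemma shift_delta_r x y k (t : R) : row_mx x (t *: delta_mx 0 k + y) =
  t *: delta_mx 0 (rshift n1 k) + row_mx x y.
Proof.
apply/rowP => j; rewrite -[j]splitK; case: (fintype.split j) => i /=.
- by rewrite row_mxEl [RHS]mxE row_mxEl !mxE eq_lrshift andbF mulr0 add0r.
- by rewrite row_mxEr [LHS]mxE [RHS]mxE row_mxEr !mxE (inj_eq (@rshift_inj _ _)).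
Qed.

Lemma partial_slice_l f y k :
  partial k (fun x => f (row_mx x y)) = fun x => partial (lshift n2 k) f (row_mx x y).
Proof.
apply/funext => x; rewrite /partial /derive; congr (lim (_ @ 0^')).
by apply/funext => t /=; rewrite shift_delta_l.
Qed.

Lemma partial_slice_r f x k :
  partial k (fun y => f (row_mx x y)) = fun y => partial (rshift n1 k) f (row_mx x y).
Proof.
apply/funext => y; rewrite /partial /derive; congr (lim (_ @ 0^')).
by apply/funext => t /=; rewrite shift_delta_r.
Qed.

Lemma smooth_on_slice_l U f y : smooth_on U f ->
  smooth_on [set x | U (row_mx x y)] (fun x => f (row_mx x y)).
Proof.
move=> sf s; have -> : partials s (fun x => f (row_mx x y)) =
    fun x => partials (map (@lshift n1 n2) s) f (row_mx x y).
  by elim: s => //= k s ->; rewrite partial_slice_l.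
move=> x /= Ux; have [c d] := sf (map (@lshift n1 n2) s) _ Ux; split.
  apply: (@continuous_comp _ _ _ (fun x => row_mx x y)) => //.
  apply: (@continuous_comp _ _ _ (fun x => (x, y)) (fun p => row_mx p.1 p.2)).
    move=> A [[A1 A2] [/= A1x A2y] A12]; apply: filterS A1x => a A1a.
    by apply: A12; split => //=; exact: nbhs_singleton A2y.
  exact: row_mx_continuous.
move=> k; have := d (lshift n2 k); rewrite /derivable.
by under eq_fun do rewrite /= -shift_delta_l.
Qed.

Lemma smooth_on_slice_r U f x : smooth_on U f ->
  smooth_on [set y | U (row_mx x y)] (fun y => f (row_mx x y)).
Proof.
move=> sf s; have -> : partials s (fun y => f (row_mx x y)) =
    fun y => partials (map (@rshift n1 n2) s) f (row_mx x y).
  by elim: s => //= k s ->; rewrite partial_slice_r.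
move=> y /= Uy; have [c d] := sf (map (@rshift n1 n2) s) _ Uy; split.
  apply: (@continuous_comp _ _ _ (fun y => row_mx x y)) => //.
  apply: (@continuous_comp _ _ _ (fun y => (x, y)) (fun p => row_mx p.1 p.2)).
    move=> A [[A1 A2] [/= A1x A2y] A12]; apply: filterS A2y => a A2a.
    by apply: A12; split => //=; exact: nbhs_singleton A1x.
  exact: row_mx_continuous.
move=> k; have := d (rshift n1 k); rewrite /derivable.
by under eq_fun do rewrite /= -shift_delta_r.
Qed.

Lemma partial_lsubmx_l k (f : 'rV[R]_n1 -> R) (z : 'rV[R]_(n1 + n2)) :
  partial (lshift n2 k) (fun z => f (lsubmx z)) z = partial k f (lsubmx z).
Proof. by rewrite partial_lsubmx (unsplitK (inl k)). Qed.

Lemma partial_lsubmx_r k (f : 'rV[R]_n1 -> R) (z : 'rV[R]_(n1 + n2)) :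
  partial (rshift n1 k) (fun z => f (lsubmx z)) z = 0.
Proof. by rewrite partial_lsubmx (unsplitK (inr k)). Qed.

Lemma partial_rsubmx_l k (f : 'rV[R]_n2 -> R) (z : 'rV[R]_(n1 + n2)) :
  partial (lshift n2 k) (fun z => f (rsubmx z)) z = 0.
Proof. by rewrite partial_rsubmx (unsplitK (inl k)). Qed.

Lemma partial_rsubmx_r k (f : 'rV[R]_n2 -> R) (z : 'rV[R]_(n1 + n2)) :
  partial (rshift n1 k) (fun z => f (rsubmx z)) z = partial k f (rsubmx z).
Proof. by rewrite partial_rsubmx (unsplitK (inr k)). Qed.

Lemma open_prod (U1 : set 'rV[R]_n1) (U2 : set 'rV[R]_n2) : open U1 -> open U2 ->
  open [set z : 'rV[R]_(n1 + n2) | U1 (lsubmx z) /\ U2 (rsubmx z)].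
Proof.
move=> o1 o2; apply: (@openI _ (lsubmx @^-1` U1) (rsubmx @^-1` U2)).
- by apply: open_comp => // ? _; exact: lsubmx_continuous.
- by apply: open_comp => // ? _; exact: rsubmx_continuous.
Qed.

Lemma twisted_slit_open : open (@twisted_slit R n1 n2).
Proof. exact: open_prod slit_open slit_open. Qed.

End Slices.

(** * Finsler metrics in a single chart *)

Section LocalFinsler.
Context {R : realType} {n : nat}.
Variables (U : set 'rV[R]_n) (F : 'rV[R]_n -> 'rV[R]_n -> R).
Implicit Types x y : 'rV[R]_n.

(** The assumptions concern the energy, from which all the tensors are built. Smoothness is joint in
    (x, y) because the spray mixes base and fibre derivatives. *)
Definition local_finsler : Prop :=
  [/\ smooth_on [set z : 'rV[R]_(n + n) | U (lsubmx z) /\ rsubmx z != 0]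
        (fun z => energy F (lsubmx z) (rsubmx z)),
      forall x y (l : R), U x -> 0 < l ->
        energy F x (l *: y) = l ^+ 2 * energy F x y
    & forall x (y w : 'rV[R]_n), U x -> y != 0 -> w != 0 ->
        0 < \sum_i \sum_j fund F x y i j * w 0 i * w 0 j].

Hypothesis UF : local_finsler.

(** On pairs of base point and fibre vector, [pdx] and [pdy] become partials in the left and the
    right block. *)
Let E (z : 'rV[R]_(n + n)) := energy F (lsubmx z) (rsubmx z).
Let W := [set z : 'rV[R]_(n + n) | U (lsubmx z) /\ rsubmx z != 0].

Let E_smooth : smooth_on W E.
Proof. by have [] := UF. Qed.

Let energy_row x y : energy F x y = E (row_mx x y).
Proof. by rewrite /E row_mxKl row_mxKr. Qed.

Let pdy_row l x y : pdy l (energy F) x y = partial (rshift n l) E (row_mx x y).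
Proof.
rewrite /pdy (_ : energy F x = fun y => E (row_mx x y)) ?partial_slice_r //.
by apply/funext => z; exact: energy_row.
Qed.

Let slice_l (f : 'rV[R]_(n + n) -> R) y : smooth_on W f -> y != 0 ->
  smooth_on U (fun x => f (row_mx x y)).
Proof.
move=> sf y0; apply: (smooth_onW _ (smooth_on_slice_l sf)) => x Ux.
by rewrite /W /= row_mxKl row_mxKr.
Qed.

Let slice_r (f : 'rV[R]_(n + n) -> R) x : smooth_on W f -> U x ->
  smooth_on slit (fun y => f (row_mx x y)).
Proof.
move=> sf Ux; apply: (smooth_onW _ (smooth_on_slice_r sf)) => y y0.
by rewrite /W /= row_mxKl row_mxKr.
Qed.

Lemma local_energy_smooth x : U x -> smooth_on slit (energy F x).
Proof.
move=> Ux; rewrite (_ : energy F x = fun y => E (row_mx x y)).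
  exact: slice_r.
by apply/funext => y; exact: energy_row.
Qed.

Lemma local_energy_smooth_base y : y != 0 -> smooth_on U (fun x => energy F x y).
Proof.
by move=> y0; under eq_fun do rewrite energy_row; exact: slice_l.
Qed.

Lemma local_pdy_smooth_base l y : y != 0 ->
  smooth_on U (fun x => pdy l (energy F) x y).
Proof.
move=> y0; under eq_fun do rewrite pdy_row.
exact: slice_l (smooth_on_partial _ E_smooth) y0.
Qed.

Lemma local_spray_smooth i x : U x -> smooth_on slit (spray F i x).
Proof.
move=> Ux; have [_ hF pF] := UF; apply: spray_smooth.
- exact: local_energy_smooth.
- by move=> y w; exact: pF.
- move=> l; rewrite (_ : pdx l (energy F) x =
      fun y => partial (lshift n l) E (row_mx x y)).
    exact: slice_r (smooth_on_partial _ E_smooth) Ux.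
  apply/funext => y; rewrite /pdx; under eq_fun do rewrite energy_row.
  by rewrite partial_slice_l.
- move=> k l; rewrite (_ : pdx k (pdy l (energy F)) x =
      fun y => partial (lshift n k) (partial (rshift n l) E) (row_mx x y)).
    exact: slice_r (smooth_on_partial _ (smooth_on_partial _ E_smooth)) Ux.
  apply/funext => y; rewrite /pdx; under eq_fun do rewrite pdy_row.
  by rewrite partial_slice_l.
Qed.

Lemma local_homog x : U x -> forall y (l : R), 0 < l ->
  energy F x (l *: y) = l ^+ 2 * energy F x y.
Proof. by move=> Ux y l; have [_ + _] := UF; exact. Qed.

Lemma local_posdef x : U x -> forall y w : 'rV[R]_n, y != 0 -> w != 0 ->
  0 < \sum_i \sum_j fund F x y i j * w 0 i * w 0 j.
Proof. by move=> Ux y w; have [_ _ +] := UF; exact. Qed.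

End LocalFinsler.

Lemma finsler_local (R : realType) (n : nat) (M : manifold R n)
  (F : finsler_metric M) (c : chart M) : local_finsler (chart_img c) (F c).
Proof.
split; last exact: finsler_posdef.
- apply: smooth_onM; try exact: finsler_smooth.
  apply: (@open_prod _ _ _ (chart_img c) slit); last exact: slit_open.
  exact: chart_img_open.
- by move=> x y l Ux l0; rewrite /energy finsler_homog // exprMn.
Qed.

(** * Separated functions of the two fibre variables *)

Section Separated.
Context {R : realType} {n1 n2 : nat}.
Implicit Types (P a : 'rV[R]_n1 -> R) (Q b : 'rV[R]_n2 -> R).
Local Notation T := (@twisted_slit R n1 n2).

Lemma smooth_on_twisted_l P : smooth_on slit P -> smooth_on T (fun w => P (lsubmx w)).
Proof. by move=> sf; apply: (smooth_onW _ (smooth_on_lsubmx sf)) => w []. Qed.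

Lemma smooth_on_twisted_r Q : smooth_on slit Q -> smooth_on T (fun w => Q (rsubmx w)).
Proof. by move=> sf; apply: (smooth_onW _ (smooth_on_rsubmx sf)) => w []. Qed.

(** Closed under partials: a derivative in y replaces (P, Q, a, b) by (P', 0, a', b), one in v by
    (0, Q', a, b'). One coupling product is enough for the spray and for its divergence. *)
Definition separated P Q a b (w : 'rV[R]_(n1 + n2)) : R :=
  P (lsubmx w) + Q (rsubmx w) + a (lsubmx w) * b (rsubmx w).

Variables (P a : 'rV[R]_n1 -> R) (Q b : 'rV[R]_n2 -> R).
Hypotheses (sP : smooth_on slit P) (sQ : smooth_on slit Q).
Hypotheses (sa : smooth_on slit a) (sb : smooth_on slit b).

Lemma separated_smooth : smooth_on T (separated P Q a b).
Proof.
have oT := @twisted_slit_open R n1 n2.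
have s1 := smooth_onD oT (smooth_on_twisted_l sP) (smooth_on_twisted_r sQ).
have s2 := smooth_onM oT (smooth_on_twisted_l sa) (smooth_on_twisted_r sb).
exact: smooth_onD oT s1 s2.
Qed.

Let partial_separated i w : T w -> partial i (separated P Q a b) w =
  partial i (fun w => P (lsubmx w)) w + partial i (fun w => Q (rsubmx w)) w +
  (a (lsubmx w) * partial i (fun w => b (rsubmx w)) w +
   b (rsubmx w) * partial i (fun w => a (lsubmx w)) w).
Proof.
move=> Tw.
have dP := smooth_on_derivable (i := i) (smooth_on_twisted_l sP) Tw.
have dQ := smooth_on_derivable (i := i) (smooth_on_twisted_r sQ) Tw.
have da := smooth_on_derivable (i := i) (smooth_on_twisted_l sa) Tw.
have db := smooth_on_derivable (i := i) (smooth_on_twisted_r sb) Tw.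
transitivity (partial i (fun w => P (lsubmx w) + Q (rsubmx w)) w +
              partial i (fun w => a (lsubmx w) * b (rsubmx w)) w).
  exact: partialD (derivableD dP dQ) (derivableM da db).
by rewrite (partialD dP dQ) (partialM da db).
Qed.

Lemma partial_separated_l k w : T w -> partial (lshift n2 k) (separated P Q a b) w =
  separated (partial k P) (fun=> 0) (partial k a) b w.
Proof.
move=> Tw; rewrite partial_separated // /separated.
rewrite !partial_lsubmx_l !partial_rsubmx_l mulr0 add0r.
by rewrite [X in _ + X]mulrC.
Qed.

Lemma partial_separated_r k w : T w -> partial (rshift n1 k) (separated P Q a b) w =
  separated (fun=> 0) (partial k Q) a (partial k b) w.
Proof.
move=> Tw; rewrite partial_separated // /separated.
by rewrite !partial_lsubmx_r !partial_rsubmx_r mulr0 addr0.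
Qed.

End Separated.

Section SeparatedHessian.
Context {R : realType} {n1 n2 : nat}.
Variables (P a : 'rV[R]_n1 -> R) (Q b : 'rV[R]_n2 -> R) (w : 'rV[R]_(n1 + n2)).
Hypotheses (sP : smooth_on slit P) (sQ : smooth_on slit Q).
Hypotheses (sa : smooth_on slit a) (sb : smooth_on slit b).
Hypothesis Tw : @twisted_slit R n1 n2 w.
Let oT := @twisted_slit_open R n1 n2.
Let s0 n : smooth_on slit (fun _ : 'rV[R]_n => 0) := smooth_on_cst 0.

Lemma hessian_separated_ll j k :
  partial (lshift n2 j) (partial (lshift n2 k) (separated P Q a b)) w =
  partial j (partial k P) (lsubmx w) +
  partial j (partial k a) (lsubmx w) * b (rsubmx w).
Proof.
rewrite (eq_on_partial _ oT (partial_separated_l sP sQ sa sb k) Tw).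
by rewrite (partial_separated_l (smooth_on_partial k sP) (@s0 _) (smooth_on_partial k sa) sb j Tw)
  /separated addr0.
Qed.

Lemma hessian_separated_lr j k :
  partial (lshift n2 j) (partial (rshift n1 k) (separated P Q a b)) w =
  partial j a (lsubmx w) * partial k b (rsubmx w).
Proof.
rewrite (eq_on_partial _ oT (partial_separated_r sP sQ sa sb k) Tw).
by rewrite (partial_separated_l (@s0 _) (smooth_on_partial k sQ) sa
  (smooth_on_partial k sb) j Tw) /separated partial_cst !add0r.
Qed.

Lemma hessian_separated_rr j k :
  partial (rshift n1 j) (partial (rshift n1 k) (separated P Q a b)) w =
  partial j (partial k Q) (rsubmx w) +
  a (lsubmx w) * partial j (partial k b) (rsubmx w).
Proof.
rewrite (eq_on_partial _ oT (partial_separated_r sP sQ sa sb k) Tw).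
by rewrite (partial_separated_r (@s0 _) (smooth_on_partial k sQ) sa
  (smooth_on_partial k sb) j Tw) /separated add0r.
Qed.

End SeparatedHessian.

(** * The spray of a twisted product *)

Section TwistedEnergy.
Context {R : realType} {n1 n2 : nat}.
Variables (U1 : set 'rV[R]_n1) (U2 : set 'rV[R]_n2).
Variables (F1 : 'rV[R]_n1 -> 'rV[R]_n1 -> R) (F2 : 'rV[R]_n2 -> 'rV[R]_n2 -> R).
Variables (r : 'rV[R]_(n1 + n2) -> R) (F : 'rV[R]_(n1 + n2) -> 'rV[R]_(n1 + n2) -> R).

Local Notation U := [set z : 'rV[R]_(n1 + n2) | U1 (lsubmx z) /\ U2 (rsubmx z)].
Local Notation T := (@twisted_slit R n1 n2).

Hypotheses (oU1 : open U1) (oU2 : open U2).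
Hypotheses (UF1 : local_finsler U1 F1) (UF2 : local_finsler U2 F2).
Hypothesis r_gt0 : forall z, 0 < r z.
Hypothesis r_smooth : smooth_on U r.
Hypothesis FE : forall z w, energy F z w =
  energy F1 (lsubmx z) (lsubmx w) + r z ^+ 2 * energy F2 (rsubmx z) (rsubmx w).

Let energyE z : energy F z = fun w =>
  energy F1 (lsubmx z) (lsubmx w) + r z ^+ 2 * energy F2 (rsubmx z) (rsubmx w).
Proof. by apply/funext => w; exact: FE. Qed.

Let oU : open U. Proof. exact: open_prod. Qed.
Let oT : open T. Proof. exact: twisted_slit_open. Qed.

Let rn0 z : r z != 0. Proof. by rewrite gt_eqF. Qed.

Let lift1U (f : 'rV[R]_n1 -> R) : smooth_on U1 f ->
  smooth_on U (fun z => f (lsubmx z)).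
Proof. by move=> sf; apply: (smooth_onW _ (smooth_on_lsubmx sf)) => w []. Qed.

Let lift2U (f : 'rV[R]_n2 -> R) : smooth_on U2 f ->
  smooth_on U (fun z => f (rsubmx z)).
Proof. by move=> sf; apply: (smooth_onW _ (smooth_on_rsubmx sf)) => w []. Qed.

Lemma twisted_pdy_l z w l : U z -> T w ->
  pdy (lshift n2 l) (energy F) z w = pdy l (energy F1) (lsubmx z) (lsubmx w).
Proof.
move=> [Uz1 Uz2] Tw; rewrite /pdy energyE.
transitivity (partial (lshift n2 l) (separated (energy F1 (lsubmx z))
    (fun v => r z ^+ 2 * energy F2 (rsubmx z) v) (fun=> 0) (fun=> 0)) w).
  apply: (congr1 (fun f => partial _ f w)); apply/funext => w' /=.
  by rewrite /separated mulr0 addr0.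
rewrite (partial_separated_l (local_energy_smooth UF1 Uz1)
  (smooth_onZ _ slit_open (local_energy_smooth UF2 Uz2)) (smooth_on_cst _)
  (smooth_on_cst _) l Tw).
by rewrite /separated mulr0 !addr0.
Qed.

Lemma twisted_pdy_r z w b : U z -> T w ->
  pdy (rshift n1 b) (energy F) z w =
  r z ^+ 2 * pdy b (energy F2) (rsubmx z) (rsubmx w).
Proof.
move=> [Uz1 Uz2] Tw; rewrite /pdy energyE.
transitivity (partial (rshift n1 b) (separated (energy F1 (lsubmx z))
    (fun v => r z ^+ 2 * energy F2 (rsubmx z) v) (fun=> 0) (fun=> 0)) w).
  apply: (congr1 (fun f => partial _ f w)); apply/funext => w' /=.
  by rewrite /separated mulr0 addr0.
have sL2 := local_energy_smooth UF2 Uz2.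
rewrite (partial_separated_r (local_energy_smooth UF1 Uz1)
  (smooth_onZ _ slit_open sL2) (smooth_on_cst _) (smooth_on_cst _) b Tw).
rewrite /separated mul0r add0r addr0; apply: partialZ.
by apply: smooth_on_derivable sL2 _; case: Tw.
Qed.

Lemma twisted_fund z w : U z -> T w -> fund F z w =
  block_mx (fund F1 (lsubmx z) (lsubmx w)) 0
           0 (r z ^+ 2 *: fund F2 (rsubmx z) (rsubmx w)).
Proof.
move=> Uz Tw; have [Uz1 Uz2] := Uz; have [Tw1 Tw2] := Tw.
have El l i : pdy i (pdy (lshift n2 l) (energy F)) z w =
    partial i (fun w => pdy l (energy F1) (lsubmx z) (lsubmx w)) w.
  by apply: (eq_on_partial _ oT _ Tw) => w' Tw'; exact: twisted_pdy_l.
have Er b i : pdy i (pdy (rshift n1 b) (energy F)) z w =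
    r z ^+ 2 * partial i (fun w => pdy b (energy F2) (rsubmx z) (rsubmx w)) w.
  transitivity (partial i
      (fun w => r z ^+ 2 * pdy b (energy F2) (rsubmx z) (rsubmx w)) w).
    by apply: (eq_on_partial _ oT _ Tw) => w' Tw'; exact: twisted_pdy_r.
  apply: partialZ; apply: smooth_on_derivable Tw; apply: smooth_on_twisted_r.
  exact: smooth_on_partial (local_energy_smooth UF2 Uz2).
apply/matrixP => i j.
rewrite -[i]splitK -[j]splitK.
case: (fintype.split i) => i'; case: (fintype.split j) => j' /=.
- rewrite block_mxEul [LHS]mxE [RHS]mxE El.
  apply: (congr1 (fun t => _ * t)); exact: partial_lsubmx_l.
- rewrite block_mxEur [LHS]mxE [RHS]mxE El.
  by rewrite [X in _ * X]partial_lsubmx_r mulr0.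
- rewrite block_mxEdl [LHS]mxE [RHS]mxE Er.
  by rewrite [X in _ * (_ * X)]partial_rsubmx_l !mulr0.
- rewrite block_mxEdr [LHS]mxE [RHS]mxE [X in _ = _ * X]mxE Er.
  by rewrite [X in _ * (_ * X)]partial_rsubmx_r mulrCA.
Qed.

Lemma twisted_fund_inv z w : U z -> T w -> fund_inv F z w =
  block_mx (fund_inv F1 (lsubmx z) (lsubmx w)) 0
           0 (r z ^- 2 *: fund_inv F2 (rsubmx z) (rsubmx w)).
Proof.
move=> Uz Tw; have [Uz1 Uz2] := Uz; have [Tw1 Tw2] := Tw.
have u1 : fund F1 (lsubmx z) (lsubmx w) \in unitmx.
  exact: fund_unit (local_posdef UF1 Uz1) _ Tw1.
have u2 : fund F2 (rsubmx z) (rsubmx w) \in unitmx.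
  exact: fund_unit (local_posdef UF2 Uz2) _ Tw2.
have u2' : r z ^+ 2 *: fund F2 (rsubmx z) (rsubmx w) \in unitmx.
  by rewrite unitmxZ // unitfE expf_neq0.
rewrite /fund_inv twisted_fund // invmx_block_diag ?invmxZ //.
by rewrite unitmxE det_ublock unitrM -!unitmxE u1.
Qed.

Lemma twisted_pdx_pdy_l z w i l : U z -> T w ->
  pdx i (pdy (lshift n2 l) (energy F)) z w =
  partial i (fun z => pdy l (energy F1) (lsubmx z) (lsubmx w)) z.
Proof.
move=> Uz Tw; apply: (eq_on_partial _ oU _ Uz) => z' Uz'; exact: twisted_pdy_l.
Qed.

Lemma partial_sqr_twist (f : 'rV[R]_n2 -> R) z i : smooth_on U2 f -> U z ->
  partial i (fun z => r z ^+ 2 * f (rsubmx z)) z =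
  2 * r z * partial i r z * f (rsubmx z) +
  r z ^+ 2 * partial i (fun z => f (rsubmx z)) z.
Proof.
move=> sf Uz.
have dr := smooth_on_derivable (i := i) r_smooth Uz.
have df := smooth_on_derivable (i := i) (lift2U sf) Uz.
under eq_fun do rewrite expr2.
rewrite (partialM (derivableM dr dr) df) (partialM dr dr).
by rewrite addrC expr2 mulrC; congr (_ * _ + _); ring.
Qed.

Lemma twisted_pdx_pdy_r z w i b : U z -> T w ->
  pdx i (pdy (rshift n1 b) (energy F)) z w =
  2 * r z * partial i r z * pdy b (energy F2) (rsubmx z) (rsubmx w) +
  r z ^+ 2 * partial i (fun z => pdy b (energy F2) (rsubmx z) (rsubmx w)) z.
Proof.
move=> Uz Tw; have [_ Tw2] := Tw.
transitivity (partial i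
    (fun z => r z ^+ 2 * pdy b (energy F2) (rsubmx z) (rsubmx w)) z).
  by apply: (eq_on_partial _ oU _ Uz) => z' Uz'; exact: twisted_pdy_r.
exact: (partial_sqr_twist _ (local_pdy_smooth_base UF2 b Tw2) Uz).
Qed.

Lemma twisted_pdx z w i : U z -> T w ->
  pdx i (energy F) z w =
  partial i (fun z => energy F1 (lsubmx z) (lsubmx w)) z +
  (2 * r z * partial i r z * energy F2 (rsubmx z) (rsubmx w) +
   r z ^+ 2 * partial i (fun z => energy F2 (rsubmx z) (rsubmx w)) z).
Proof.
move=> Uz Tw; have [Tw1 Tw2] := Tw; rewrite /pdx.
have s1 := local_energy_smooth_base UF1 Tw1.
have s2 := local_energy_smooth_base UF2 Tw2.
have sr2 : smooth_on U (fun z => r z ^+ 2).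
  exact: (smooth_onM oU r_smooth r_smooth).
under eq_fun do rewrite FE.
rewrite partialD; last 2 first.
- exact: smooth_on_derivable (lift1U s1) Uz.
- exact: smooth_on_derivable (smooth_onM oU sr2 (lift2U s2)) Uz.
apply: (congr1 (fun t => _ + t)); exact: (partial_sqr_twist _ s2 Uz).
Qed.

Local Notation d1 z := (fun k => partial (lshift n2 k) r z).
Local Notation d2 z := (fun b => partial (rshift n1 b) r z).

(** In the upper block f enters only through the derivative -2 f f_l F_2^2 of the term -f^2 F_2^2;
    the prefactor 1/4 turns the 2 into 1/2. *)
Lemma twisted_spray_l z w i : U z -> T w ->
  spray F (lshift n2 i) z w =
  spray F1 i (lsubmx z) (lsubmx w) -
  2^-1 * r z * (\sum_l partial (lshift n2 l) r z *
    fund_inv F1 (lsubmx z) (lsubmx w) i l) * energy F2 (rsubmx z) (rsubmx w).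
Proof.
move=> Uz Tw; rewrite /spray big_split_ord /= [X in _ * (_ + X)]big1; last first.
  by move=> b _; rewrite twisted_fund_inv // block_mxEur mxE mul0r.
rewrite addr0.
have -> (s : R) (e : R) (a b : 'I_n1 -> R) :
  4^-1 * (\sum_l a l * b l) - 2^-1 * s * (\sum_l partial (lshift n2 l) r z * a l) * e
  = 4^-1 * (\sum_l a l * (b l - 2 * s * partial (lshift n2 l) r z * e)).
  rewrite -[2^-1 * s * _ * _]mulrA [_ * e]mulrC mulrA !mulr_sumr -sumrB.
  by apply: eq_bigr => l _; field.
congr (_ * _); apply: eq_bigr => l _.
rewrite twisted_fund_inv // block_mxEul; congr (_ * _).
rewrite twisted_pdx // [X in X + _ = _]big_split_ord /= [X in _ + X - _]big1; last first.
  move=> b _; rewrite (twisted_pdx_pdy_l _ _ Uz Tw).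
  by rewrite (partial_lsubmx_r _ (fun x => pdy l (energy F1) x _)) mul0r.
rewrite addr0 (partial_rsubmx_l _ (fun u => energy F2 u _)) mulr0 addr0.
rewrite (partial_lsubmx_l _ (fun x => energy F1 x _)) opprD addrA.
apply: (congr1 (fun t => t - _ - _)).
apply: eq_bigr => k _; rewrite (twisted_pdx_pdy_l _ _ Uz Tw).
by rewrite (partial_lsubmx_l _ (fun x => pdy l (energy F1) x _)) [in RHS]mxE.
Qed.

Lemma twisted_spray_r z w a : U z -> T w ->
  spray F (rshift n1 a) z w =
  spray F2 a (rsubmx z) (rsubmx w) +
  (r z)^-1 * ((linear_form (d1 z) (lsubmx w) + linear_form (d2 z) (rsubmx w)) *
    rsubmx w 0 a) -
  2^-1 * (r z)^-1 * (\sum_b partial (rshift n1 b) r z *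
    fund_inv F2 (rsubmx z) (rsubmx w) a b) * energy F2 (rsubmx z) (rsubmx w).
Proof.
move=> Uz Tw; have [Uz1 Uz2] := Uz; have [Tw1 Tw2] := Tw.
have lE k : lsubmx w 0 k = w 0 (lshift n2 k) by rewrite mxE.
have rE k : rsubmx w 0 k = w 0 (rshift n1 k) by rewrite mxE.
rewrite /spray big_split_ord /= [X in _ * (X + _)]big1; last first.
  by move=> l _; rewrite twisted_fund_inv // block_mxEdl mxE mul0r.
rewrite add0r.
(* Writing v^a as g^{ab} v_b makes every term a sum over b against g^{ab}, so the two sides can be
   compared summand by summand. *)
have <- : \sum_b fund_inv F2 (rsubmx z) (rsubmx w) a b *
    lower F2 b (rsubmx z) (rsubmx w) = rsubmx w 0 a.
  exact: (sum_fund_inv_lower (local_energy_smooth UF2 Uz2)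
    (local_posdef UF2 Uz2) _ Tw2).
(* Here s = f, t is the derivative of f along w, p_b = v_b, q_b = f_b, e = F_2^2, and d_b is the
   bracket in the spray of [F2]. The inverse of the lower block supplies s^-2. The 4 combines the 2
   of d(f^2) = 2 f df with that of d_b F_2^2 = 2 v_b. *)
have S0 (s t e : R) (c d p q : 'I_n2 -> R) : s != 0 ->
  4^-1 * (\sum_b c b * d b) + s^-1 * (t * (\sum_b c b * p b))
    - 2^-1 * s^-1 * (\sum_b q b * c b) * e
  = 4^-1 * (\sum_b (s ^- 2 * c b) *
      (4 * s * t * p b - 2 * s * q b * e + s ^+ 2 * d b)).
  move=> s0; rewrite [_ * e]mulrAC !mulr_sumr -big_split -sumrB /=.
  by apply: eq_bigr => b _; field.
rewrite (S0 _ _ _ _ _ _ _ (rn0 z)).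
congr (_ * _); apply: eq_bigr => b _.
rewrite (twisted_fund_inv Uz Tw) block_mxEdr.
have -> : (r z ^- 2 *: fund_inv F2 (rsubmx z) (rsubmx w)) a b =
    r z ^- 2 * fund_inv F2 (rsubmx z) (rsubmx w) a b by rewrite mxE.
apply: (congr1 (fun t => _ * t)).
rewrite (lowerE (local_energy_smooth UF2 Uz2) (local_homog UF2 Uz2) _ Tw2).
rewrite (twisted_pdx _ Uz Tw) (partial_rsubmx_r _ (fun u => energy F2 u _)).
rewrite (partial_lsubmx_r _ (fun x => energy F1 x _)) add0r big_split_ord /=.
under eq_bigr => k _.
  rewrite (twisted_pdx_pdy_r _ _ Uz Tw).
  rewrite (partial_rsubmx_l _ (fun u => pdy b (energy F2) u _)) mulr0 addr0.
  over.
under [X in _ + X - _]eq_bigr => k _.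
  rewrite (twisted_pdx_pdy_r _ _ Uz Tw).
  rewrite (partial_rsubmx_r _ (fun u => pdy b (energy F2) u _)) mulrDl.
  over.
rewrite big_split /=.
have S1 n (s p : R) (d e : 'I_n -> R) :
    \sum_k s * d k * p * e k = s * p * \sum_k d k * e k.
  by rewrite mulr_sumr; apply: eq_bigr => k _; ring.
have S2 n (s : R) (d e : 'I_n -> R) : \sum_k s * d k * e k = s * \sum_k d k * e k.
  by rewrite mulr_sumr; apply: eq_bigr => k _; ring.
have S3 (s t1 t2 p q e m k : R) :
    2 * s * p * t1 + (2 * s * p * t2 + s ^+ 2 * m) - (2 * s * q * e + s ^+ 2 * k) =
    4 * s * (t1 + t2) * (2^-1 * p) - 2 * s * q * e + s ^+ 2 * (m - k) by field.
rewrite S1 S1 S2 /linear_form.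
rewrite -(eq_bigr _ (fun k _ => congr1 ( *%R _) (lE k))).
rewrite -(eq_bigr _ (fun k _ => congr1 ( *%R _) (rE k))).
rewrite -(eq_bigr _ (fun k _ => congr1 ( *%R _) (rE k))).
exact: S3.
Qed.

Lemma twisted_spray_separated_l z i w : U z -> T w ->
  spray F (lshift n2 i) z w =
  separated (spray F1 i (lsubmx z)) (fun=> 0)
    (fun y => \sum_l partial (lshift n2 l) r z * fund_inv F1 (lsubmx z) y i l)
    (fun v => - (2^-1 * r z) * energy F2 (rsubmx z) v) w.
Proof.
move=> Uz Tw; rewrite twisted_spray_l // /separated.
have ac (p c q e : R) : p - c * q * e = p + 0 + q * (- c * e) by ring.
exact: ac.
Qed.

(** The part of the vertical spray component that depends on v alone; the remainder is the product
    of f^-1 f_k y^k with v^a. *)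
Let vert z a v : R := spray F2 a (rsubmx z) v +
  ((r z)^-1 * (linear_form (d2 z) v * v 0 a) +
   - (2^-1 * (r z)^-1) * ((\sum_b partial (rshift n1 b) r z *
       fund_inv F2 (rsubmx z) v a b) * energy F2 (rsubmx z) v)).

Lemma twisted_spray_separated_r z a w : U z -> T w ->
  spray F (rshift n1 a) z w =
  separated (fun=> 0) (vert z a) (fun y => (r z)^-1 * linear_form (d1 z) y)
    (fun v => v 0 a) w.
Proof.
move=> Uz Tw; rewrite twisted_spray_r // /separated /vert.
have ac (p c l1 l2 t k q e : R) :
  p + c * ((l1 + l2) * t) - k * q * e =
  0 + (p + (c * (l2 * t) + - k * (q * e))) + c * l1 * t by ring.
exact: ac.
Qed.

Let form1_smooth z i : U z -> smooth_on slit
  (fun y => \sum_l partial (lshift n2 l) r z * fund_inv F1 (lsubmx z) y i l).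
Proof.
move=> [Uz1 _]; apply: smooth_on_sum slit_open _ => l _.
apply: smooth_onZ slit_open _.
exact: fund_inv_smooth (local_energy_smooth UF1 Uz1) (local_posdef UF1 Uz1) _ _.
Qed.

Let form2_smooth z a : U z -> smooth_on slit
  (fun v => \sum_b partial (rshift n1 b) r z * fund_inv F2 (rsubmx z) v a b).
Proof.
move=> [_ Uz2]; apply: smooth_on_sum slit_open _ => l _.
apply: smooth_onZ slit_open _.
exact: fund_inv_smooth (local_energy_smooth UF2 Uz2) (local_posdef UF2 Uz2) _ _.
Qed.

Let vert_smooth z a : U z -> smooth_on slit (vert z a).
Proof.
move=> Uz; have [_ Uz2] := Uz.
apply: smooth_onD slit_open (local_spray_smooth UF2 _ Uz2) _.
apply: smooth_onD slit_open _ _; apply: smooth_onZ slit_open _.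
  exact: smooth_onM slit_open (linear_form_smooth _ slit_open) (smooth_on_coord _).
exact: smooth_onM slit_open (form2_smooth _ Uz) (local_energy_smooth UF2 Uz2).
Qed.

Lemma twisted_spray_smooth z i : U z -> smooth_on T (spray F i z).
Proof.
move=> Uz; have [Uz1 Uz2] := Uz.
rewrite -[i]splitK; case: (fintype.split i) => k /=.
- exact: (eq_on_smooth oT (fun w Tw => esym (twisted_spray_separated_l k Uz Tw))
    (separated_smooth (local_spray_smooth UF1 k Uz1) (smooth_on_cst 0)
      (form1_smooth k Uz) (smooth_onZ _ slit_open (local_energy_smooth UF2 Uz2)))).
- exact: (eq_on_smooth oT (fun w Tw => esym (twisted_spray_separated_r k Uz Tw))
    (separated_smooth (smooth_on_cst 0) (vert_smooth k Uz)
      (smooth_onZ _ slit_open (linear_form_smooth _ slit_open)) (smooth_on_coord k))).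
Qed.

(** * The fibre divergence of the spray *)

Lemma twisted_div_l z w : U z -> T w ->
  \sum_i partial (lshift n2 i) (spray F (lshift n2 i) z) w =
  spray_div F1 (lsubmx z) (lsubmx w) +
  (\sum_l partial (lshift n2 l) r z * mean_cartan F1 l (lsubmx z) (lsubmx w)) *
  (r z * energy F2 (rsubmx z) (rsubmx w)).
Proof.
move=> Uz Tw; have [Uz1 Uz2] := Uz; have [Tw1 Tw2] := Tw.
transitivity (\sum_i (partial i (spray F1 i (lsubmx z)) (lsubmx w) +
    partial i (fun y => \sum_l partial (lshift n2 l) r z *
      fund_inv F1 (lsubmx z) y i l) (lsubmx w) *
    (- (2^-1 * r z) * energy F2 (rsubmx z) (rsubmx w)))).
  apply: eq_bigr => i _.
  rewrite (eq_on_partial _ oT (fun w Tw => twisted_spray_separated_l i Uz Tw) Tw).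
  rewrite (partial_separated_l (local_spray_smooth UF1 _ Uz1) (smooth_on_cst 0)
    (form1_smooth i Uz) (smooth_onZ _ slit_open (local_energy_smooth UF2 Uz2)) i Tw).
  by rewrite /separated addr0.
rewrite big_split -mulr_suml /=; apply: (congr1 (fun t => _ + t)).
rewrite (divergence_fund_inv_form (local_energy_smooth UF1 Uz1)
  (local_posdef UF1 Uz1) (d1 z) Tw1).
(* The -2 from the divergence of g^{il} meets the -1/2 of the spray, leaving coefficient 1. *)
have ac (j c e : R) : - (2 * j) * (- (2^-1 * c) * e) = j * (c * e) by field.
exact: ac.
Qed.

Let partial_vert z a v : U z -> v != 0 -> partial a (vert z a) v =
  partial a (spray F2 a (rsubmx z)) v +
  ((r z)^-1 * (linear_form (d2 z) v + partial (rshift n1 a) r z * v 0 a) +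
   - (2^-1 * (r z)^-1) *
   ((\sum_b partial (rshift n1 b) r z * fund_inv F2 (rsubmx z) v a b) *
      partial a (energy F2 (rsubmx z)) v +
    energy F2 (rsubmx z) v *
     partial a (fun v => \sum_b partial (rshift n1 b) r z *
       fund_inv F2 (rsubmx z) v a b) v)).
Proof.
move=> Uz v0; have [_ Uz2] := Uz.
have dG := smooth_on_derivable (i := a) (local_spray_smooth UF2 a Uz2) v0.
have dE := smooth_on_derivable (i := a) (local_energy_smooth UF2 Uz2) v0.
have dB := smooth_on_derivable (i := a) (form2_smooth a Uz) v0.
have dl := smooth_on_derivable (i := a) (linear_form_smooth (d2 z) slit_open) v0.
have dv := smooth_on_derivable (i := a) (@smooth_on_coord _ _ slit a) v0.
have dlv := derivableM dl dv; have dBE := derivableM dB dE.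
have dc (c : R) (f : 'rV[R]_n2 -> R) : derivable f v (delta_mx 0 a) ->
    derivable (fun v => c * f v) v (delta_mx 0 a).
  by move=> df; apply: derivableM df; exact: derivable_cst.
rewrite /vert (partialD dG (derivableD (dc _ _ dlv) (dc _ _ dBE))).
rewrite (partialD (dc _ _ dlv) (dc _ _ dBE)) (partialZ _ dlv) (partialZ _ dBE).
rewrite (partialM dl dv) (partialM dB dE) partial_coord eqxx mulr1.
by rewrite partial_linear_form [v 0 a * _]mulrC.
Qed.

Lemma twisted_div_r z w : U z -> T w ->
  \sum_a partial (rshift n1 a) (spray F (rshift n1 a) z) w =
  n2%:R * (r z)^-1 * linear_form (d1 z) (lsubmx w) +
  (spray_div F2 (rsubmx z) (rsubmx w) +
   n2%:R * (r z)^-1 * linear_form (d2 z) (rsubmx w) +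
   (r z)^-1 * ((\sum_b partial (rshift n1 b) r z *
     mean_cartan F2 b (rsubmx z) (rsubmx w)) *
     energy F2 (rsubmx z) (rsubmx w))).
Proof.
move=> Uz Tw; have [Uz1 Uz2] := Uz; have [Tw1 Tw2] := Tw.
transitivity (\sum_a (partial a (vert z a) (rsubmx w) +
    (r z)^-1 * linear_form (d1 z) (lsubmx w))).
  apply: eq_bigr => a _.
  rewrite (eq_on_partial _ oT (fun w Tw => twisted_spray_separated_r a Uz Tw) Tw).
  rewrite (partial_separated_r (smooth_on_cst 0) (vert_smooth a Uz)
    (smooth_onZ _ slit_open (linear_form_smooth _ slit_open)) (smooth_on_coord a) a Tw).
  by rewrite /separated add0r partial_coord eqxx mulr1.
rewrite big_split /= sumr_const card_ord.
under eq_bigr do rewrite (partial_vert _ Uz Tw2).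
rewrite big_split /= big_split /= -!mulr_sumr big_split /= sumr_const card_ord.
rewrite big_split /= -mulr_sumr.
rewrite (sum_fund_inv_form (local_energy_smooth UF2 Uz2) (local_homog UF2 Uz2)
  (local_posdef UF2 Uz2) (d2 z) Tw2).
rewrite (divergence_fund_inv_form (local_energy_smooth UF2 Uz2)
  (local_posdef UF2 Uz2) (d2 z) Tw2).
(* Differentiating f_b v^b v^a gives (n2 + 1) f_b v^b, and differentiating F_2^2 in the last term of
   the spray removes one copy; only a linear form with coefficient n2 remains. *)
have ac (p c l1 l2 k e : R) :
  p + (c * (l2 *+ n2 + l2) + - (2^-1 * c) * (2 * l2 + e * - (2 * k))) +
    (c * l1) *+ n2 =
  n2%:R * c * l1 + (p + n2%:R * c * l2 + c * (k * e)).
  by rewrite -mulr_natl -(mulr_natl (c * l1)); field.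
exact: ac.
Qed.

Lemma twisted_spray_div z w : U z -> T w -> spray_div F z w =
  separated
    (fun y => spray_div F1 (lsubmx z) y + n2%:R * (r z)^-1 * linear_form (d1 z) y)
    (fun v => spray_div F2 (rsubmx z) v + n2%:R * (r z)^-1 * linear_form (d2 z) v +
       (r z)^-1 * ((\sum_b partial (rshift n1 b) r z * mean_cartan F2 b (rsubmx z) v) *
         energy F2 (rsubmx z) v))
    (fun y => \sum_l partial (lshift n2 l) r z * mean_cartan F1 l (lsubmx z) y)
    (fun v => r z * energy F2 (rsubmx z) v) w.
Proof.
move=> Uz Tw; rewrite /spray_div big_split_ord /= twisted_div_l // twisted_div_r //.
have ac (p q s t : R) : p + q + (s + t) = p + s + t + q by ring.
exact: ac.
Qed.

(** [J] is I^h f_h and [K] is I^nu f_nu over the base point [z]; [P], [Q], [J], [L] are the four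
    slots of the separated divergence. *)
Local Notation J z := (fun y =>
  \sum_l partial (lshift n2 l) r z * mean_cartan F1 l (lsubmx z) y).
Local Notation K z := (fun v =>
  \sum_b partial (rshift n1 b) r z * mean_cartan F2 b (rsubmx z) v).
Local Notation P z := (fun y =>
  spray_div F1 (lsubmx z) y + n2%:R * (r z)^-1 * linear_form (d1 z) y).
Local Notation Q z := (fun v =>
  spray_div F2 (rsubmx z) v + n2%:R * (r z)^-1 * linear_form (d2 z) v +
  (r z)^-1 * (K z v * energy F2 (rsubmx z) v)).
Local Notation L z := (fun v => r z * energy F2 (rsubmx z) v).

Let div1_smooth z : U z -> smooth_on slit (spray_div F1 (lsubmx z)).
Proof.
move=> [Uz1 _].
exact: spray_div_smooth slit_open (fun i => local_spray_smooth UF1 i Uz1).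
Qed.

Let div2_smooth z : U z -> smooth_on slit (spray_div F2 (rsubmx z)).
Proof.
move=> [_ Uz2].
exact: spray_div_smooth slit_open (fun i => local_spray_smooth UF2 i Uz2).
Qed.

Let J_smooth z : U z -> smooth_on slit (J z).
Proof.
move=> [Uz1 _].
exact: (mean_cartan_form_smooth (local_energy_smooth UF1 Uz1) (local_posdef UF1 Uz1)
  (d1 z)).
Qed.

Let K_smooth z : U z -> smooth_on slit (K z).
Proof.
move=> [_ Uz2].
exact: (mean_cartan_form_smooth (local_energy_smooth UF2 Uz2) (local_posdef UF2 Uz2)
  (d2 z)).
Qed.

Let KL_smooth z : U z -> smooth_on slit (fun v => K z v * energy F2 (rsubmx z) v).
Proof.
move=> Uz; have [_ Uz2] := Uz.
exact: (smooth_onM slit_open (K_smooth Uz) (local_energy_smooth UF2 Uz2)).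
Qed.

Let S2_smooth z : U z -> smooth_on slit (fun v =>
  spray_div F2 (rsubmx z) v + n2%:R * (r z)^-1 * linear_form (d2 z) v).
Proof.
move=> Uz.
exact: (smooth_onD slit_open (div2_smooth Uz)
  (smooth_onZ _ slit_open (linear_form_smooth _ slit_open))).
Qed.

Let P_smooth z : U z -> smooth_on slit (P z).
Proof.
move=> Uz.
exact: (smooth_onD slit_open (div1_smooth Uz)
  (smooth_onZ _ slit_open (linear_form_smooth _ slit_open))).
Qed.

Let Q_smooth z : U z -> smooth_on slit (Q z).
Proof.
move=> Uz.
exact: (smooth_onD slit_open (S2_smooth Uz) (smooth_onZ _ slit_open (KL_smooth Uz))).
Qed.

Let L_smooth z : U z -> smooth_on slit (L z).
Proof.
move=> [_ Uz2]; exact: (smooth_onZ _ slit_open (local_energy_smooth UF2 Uz2)).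
Qed.

(** * The blocks of the mean Berwald curvature *)

Let twisted_hessian z w i j : U z -> T w -> mean_berwald F i j z w =
  2^-1 * partial i (partial j (separated (P z) (Q z) (J z) (L z))) w.
Proof.
move=> Uz Tw.
rewrite (mean_berwaldE _ _ oT (fun i => @twisted_spray_smooth z i Uz) Tw).
apply: (congr1 (fun t => _ * t)); apply: (eq_on_partial _ oT _ Tw) => w' Tw'.
by apply: (eq_on_partial _ oT _ Tw') => w'' Tw''; exact: twisted_spray_div.
Qed.

Lemma twisted_berwald_ll z w j k : U z -> T w ->
  mean_berwald F (lshift n2 j) (lshift n2 k) z w =
  mean_berwald F1 j k (lsubmx z) (lsubmx w) +
  2^-1 * (partial j (partial k (J z)) (lsubmx w) *
    (r z * energy F2 (rsubmx z) (rsubmx w))).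
Proof.
move=> Uz Tw; have [Uz1 Uz2] := Uz; have [Tw1 Tw2] := Tw.
rewrite (twisted_hessian _ _ Uz Tw).
rewrite (hessian_separated_ll (P_smooth Uz) (Q_smooth Uz) (J_smooth Uz)
  (L_smooth Uz) Tw).
rewrite (partial2DZ _ _ _ slit_open (div1_smooth Uz)
  (linear_form_smooth _ slit_open) Tw1) partial2_linear_form mulr0 addr0.
rewrite (mean_berwaldE _ _ slit_open (fun i => local_spray_smooth UF1 i Uz1) Tw1).
exact: mulrDr.
Qed.

Lemma twisted_berwald_lr z w j b : U z -> T w ->
  mean_berwald F (lshift n2 j) (rshift n1 b) z w =
  2^-1 * (partial j (J z) (lsubmx w) *
    (r z * partial b (energy F2 (rsubmx z)) (rsubmx w))).
Proof.
move=> Uz Tw; have [Uz1 Uz2] := Uz; have [Tw1 Tw2] := Tw.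
rewrite (twisted_hessian _ _ Uz Tw).
rewrite (hessian_separated_lr (P_smooth Uz) (Q_smooth Uz) (J_smooth Uz)
  (L_smooth Uz) Tw).
have dL := smooth_on_derivable (i := b) (local_energy_smooth UF2 Uz2) Tw2.
by rewrite (partialZ (r z) dL).
Qed.

Lemma twisted_berwald_rl z w j b : U z -> T w ->
  mean_berwald F (rshift n1 b) (lshift n2 j) z w =
  mean_berwald F (lshift n2 j) (rshift n1 b) z w.
Proof.
move=> Uz Tw; rewrite [LHS](twisted_hessian _ _ Uz Tw) [RHS](twisted_hessian _ _ Uz Tw).
apply: (congr1 (fun t => _ * t)).
exact: (partial_comm _ _ oT (separated_smooth (P_smooth Uz) (Q_smooth Uz)
  (J_smooth Uz) (L_smooth Uz)) Tw).
Qed.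

Lemma twisted_berwald_rr z w a b : U z -> T w ->
  mean_berwald F (rshift n1 a) (rshift n1 b) z w =
  mean_berwald F2 a b (rsubmx z) (rsubmx w) +
  2^-1 * ((r z)^-1 * partial a (partial b
      (fun v => K z v * energy F2 (rsubmx z) v)) (rsubmx w)) +
  J z (lsubmx w) * (2^-1 * partial a (partial b (L z)) (rsubmx w)).
Proof.
move=> Uz Tw; have [Uz1 Uz2] := Uz; have [Tw1 Tw2] := Tw.
rewrite (twisted_hessian _ _ Uz Tw).
rewrite (hessian_separated_rr (P_smooth Uz) (Q_smooth Uz) (J_smooth Uz)
  (L_smooth Uz) Tw).
rewrite (partial2DZ _ _ _ slit_open (S2_smooth Uz) (KL_smooth Uz) Tw2).
rewrite (partial2DZ _ _ _ slit_open (div2_smooth Uz)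
  (linear_form_smooth _ slit_open) Tw2) partial2_linear_form mulr0 addr0.
rewrite (mean_berwaldE _ _ slit_open (fun i => local_spray_smooth UF2 i Uz2) Tw2).
have ac (p q s t : R) : 2^-1 * (p + q + s * t) =
  2^-1 * p + 2^-1 * q + s * (2^-1 * t) by ring.
exact: ac.
Qed.

(** Over a fixed base point only fibre derivatives occur, so the equivalence needs no comparison of
    different base points. The fixed vectors [y0] and [v0] serve to test conditions that involve
    only the other fibre. *)
Lemma twisted_weakly_berwald_at z : (0 < n1)%N -> (0 < n2)%N -> U z ->
  (forall w, T w -> forall i j, mean_berwald F i j z w = 0) <->
  [/\ (forall y, y != 0 -> forall j k, mean_berwald F1 j k (lsubmx z) y = 0),
      (forall y, y != 0 -> J z y = 0)
    & (forall v, v != 0 -> forall a b, mean_berwald F2 a b (rsubmx z) v =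
        - (2^-1 * ((r z)^-1 * partial a (partial b
            (fun v => K z v * energy F2 (rsubmx z) v)) v)))].
Proof.
move=> n1_gt0 n2_gt0 Uz; have [Uz1 Uz2] := Uz.
have [y0 y0n0] : exists y : 'rV[R]_n1, y != 0.
  exists (delta_mx 0 (Ordinal n1_gt0)); apply/eqP => /rowP/(_ (Ordinal n1_gt0)).
  by rewrite !mxE !eqxx => /eqP; rewrite oner_eq0.
have [v0 v0n0] : exists v : 'rV[R]_n2, v != 0.
  exists (delta_mx 0 (Ordinal n2_gt0)); apply/eqP => /rowP/(_ (Ordinal n2_gt0)).
  by rewrite !mxE !eqxx => /eqP; rewrite oner_eq0.
have Tr (y : 'rV[R]_n1) (v : 'rV[R]_n2) : y != 0 -> v != 0 -> T (row_mx y v).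
  by move=> yn0 vn0; rewrite /twisted_slit /= row_mxKl row_mxKr.
have E2_gt0 (v : 'rV[R]_n2) : v != 0 -> 0 < energy F2 (rsubmx z) v.
  exact: (energy_gt0 (local_energy_smooth UF2 Uz2) (local_homog UF2 Uz2)
    (local_posdef UF2 Uz2)).
split=> [WB | [WB1 J0 WB2]].
- have J0 y : y != 0 -> J z y = 0.
    move=> yn0; apply: oppr_inj; rewrite oppr0.
    rewrite -(euler_mean_cartan_form (local_energy_smooth UF1 Uz1) (local_homog UF1 Uz1)
      (local_posdef UF1 Uz1) (d1 z) yn0).
    rewrite big1 // => j _; apply/eqP; rewrite mulf_eq0; apply/orP; right.
    (* Contracting the mixed block with v^b turns d_b F_2^2 into 2 F_2^2, which is nonzero at [v0];
       this isolates the derivative of [J z]. *)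
    have : partial j (J z) y * (r z * energy F2 (rsubmx z) v0) = 0.
      rewrite -(sum_lower (local_energy_smooth UF2 Uz2) (local_homog UF2 Uz2) v0n0).
      rewrite !mulr_sumr big1 // => b _.
      have := WB _ (Tr y v0 yn0 v0n0) (lshift n2 j) (rshift n1 b).
      rewrite (twisted_berwald_lr _ _ Uz (Tr y v0 yn0 v0n0)) row_mxKl row_mxKr => H.
      rewrite (lowerE (local_energy_smooth UF2 Uz2) (local_homog UF2 Uz2) _ v0n0).
      have ac (p c e q : R) : p * (c * (2^-1 * e * q)) = 2^-1 * (p * (c * e)) * q.
        by ring.
      by rewrite ac H mul0r.
    move/eqP; rewrite mulf_eq0 => /orP[//|].
    by rewrite mulf_eq0 (negPf (rn0 z)) gt_eqF ?E2_gt0.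
  split => //.
  + move=> y yn0 j k.
    (* Doubling [v0] multiplies F_2^2 by 4 and leaves the [F1] term alone; four times the first
       equation minus the second is three times that term. *)
    have v1n0 : (2 : R) *: v0 != 0 by rewrite scaler_eq0 negb_or v0n0 pnatr_eq0.
    have := WB _ (Tr y v0 yn0 v0n0) (lshift n2 j) (lshift n2 k).
    rewrite (twisted_berwald_ll _ _ Uz (Tr y v0 yn0 v0n0)) row_mxKl row_mxKr => H1.
    have := WB _ (Tr y _ yn0 v1n0) (lshift n2 j) (lshift n2 k).
    rewrite (twisted_berwald_ll _ _ Uz (Tr y _ yn0 v1n0)) row_mxKl row_mxKr.
    rewrite (local_homog UF2 Uz2 _ (ltr0Sn R 1)) => H2.
    have ac (p q c e : R) : p + 2^-1 * (q * (c * e)) = 0 ->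
        p + 2^-1 * (q * (c * (2 ^+ 2 * e))) = 0 -> p = 0.
      move=> e1 e2; apply: (@mulfI _ 3); first by rewrite pnatr_eq0.
      have -> : 3 * p = 4 * (p + 2^-1 * (q * (c * e))) -
          (p + 2^-1 * (q * (c * (2 ^+ 2 * e)))) by ring.
      by rewrite e1 e2 !mulr0 subrr.
    exact: ac H1 H2.
  + move=> v vn0 a b.
    have := WB _ (Tr y0 v y0n0 vn0) (rshift n1 a) (rshift n1 b).
    rewrite (twisted_berwald_rr _ _ Uz (Tr y0 v y0n0 vn0)) row_mxKl row_mxKr.
    by rewrite (J0 _ y0n0) mul0r addr0 => /eqP; rewrite addr_eq0 => /eqP.
- move=> w Tw i j; have [Tw1 Tw2] := Tw.
  (* [J z] vanishes on an open set, hence so do its derivatives, and the coupling drops out of every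
     block. *)
  have dJ k y : y != 0 -> partial k (J z) y = 0.
    by move=> yn0; rewrite (eq_on_partial _ slit_open J0 yn0) partial_cst.
  have lr k b : mean_berwald F (lshift n2 k) (rshift n1 b) z w = 0.
    by rewrite (twisted_berwald_lr _ _ Uz Tw) (dJ _ _ Tw1) mul0r mulr0.
  rewrite -[i]splitK -[j]splitK.
  case: (fintype.split i) => k; case: (fintype.split j) => l /=.
  + rewrite (twisted_berwald_ll _ _ Uz Tw) (WB1 _ Tw1) add0r.
    by rewrite (eq_on_partial _ slit_open (dJ l) Tw1) partial_cst mul0r mulr0.
  + exact: lr.
  + by rewrite (twisted_berwald_rl _ _ Uz Tw).
  + rewrite (twisted_berwald_rr _ _ Uz Tw) (WB2 _ Tw2) (J0 _ Tw1) mul0r addr0.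
    exact: addNr.
Qed.

End TwistedEnergy.

(** * Passage to charts of the product manifold *)

Section TwistedCharts.
Context {R : realType} {n1 n2 : nat}.
Variables (M1 : manifold R n1) (M2 : manifold R n2).
Variables (F1 : finsler_metric M1) (F2 : finsler_metric M2).
Variable f : prod_manifold M1 M2 -> R.
Variables (c1 : chart M1) (c2 : chart M2).

Local Notation c := ((c1, c2) : chart (prod_manifold M1 M2)).
Local Notation r := (fun z => f (Defs.point c z)).

Lemma df1E h z :
  df1 f c1 c2 h (lsubmx z) (rsubmx z) = partial (lshift n2 h) r z.
Proof.
rewrite -[in RHS](hsubmxK z).
have := partial_slice_l r (rsubmx z) h => /(congr1 (@^~ (lsubmx z))) /= <-.
apply: (congr1 (fun g => partial h g (lsubmx z))); apply/funext => x /=.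
by rewrite /floc row_mxKl row_mxKr.
Qed.

Lemma df2E b z :
  df2 f c1 c2 b (lsubmx z) (rsubmx z) = partial (rshift n1 b) r z.
Proof.
rewrite -[in RHS](hsubmxK z).
have := partial_slice_r r (lsubmx z) b => /(congr1 (@^~ (rsubmx z))) /= <-.
apply: (congr1 (fun g => partial b g (rsubmx z))); apply/funext => u /=.
by rewrite /floc row_mxKl row_mxKr.
Qed.

(** Both summands under the root are nonnegative as products of squares, so squaring undoes the root
    on the whole fibre, the zero vectors included. *)
Lemma energy_twisted z w : energy (twisted F1 F2 f c) z w =
  energy (F1 c1) (lsubmx z) (lsubmx w) +
  r z ^+ 2 * energy (F2 c2) (rsubmx z) (rsubmx w).
Proof.
rewrite /energy /twisted sqr_sqrtr //.
by apply: addr_ge0; [exact: sqr_ge0|apply: mulr_ge0; exact: sqr_ge0].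
Qed.

Lemma twisted_chart_weakly_berwald x u : (0 < n1)%N -> (0 < n2)%N ->
  smooth_fun f -> (forall p, 0 < f p) -> chart_img c1 x -> chart_img c2 u ->
  (forall w, twisted_slit w -> forall i j,
     mean_berwald (twisted F1 F2 f c) i j (row_mx x u) w = 0) <->
  [/\ (forall y, y != 0 -> forall j k, mean_berwald (F1 c1) j k x y = 0),
      (forall y, y != 0 ->
         \sum_h mean_cartan (F1 c1) h x y * df1 f c1 c2 h x u = 0)
    & (forall v, v != 0 -> forall a b, mean_berwald (F2 c2) a b u v =
        - (2^-1 * ((floc f c1 c2 x u)^-1 * partial a (partial b (fun v =>
          (\sum_nu df2 f c1 c2 nu x u * mean_cartan (F2 c2) nu u v) *
          energy (F2 c2) u v)) v)))].
Proof.
move=> n1_gt0 n2_gt0 f_smooth f_gt0 Ux Uu.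
have Uz : chart_img c1 (lsubmx (row_mx x u)) /\ chart_img c2 (rsubmx (row_mx x u)).
  by rewrite row_mxKl row_mxKr.
have := @twisted_weakly_berwald_at R n1 n2 (chart_img c1) (chart_img c2) (F1 c1)
  (F2 c2) r (twisted F1 F2 f c) (@chart_img_open _ _ _ c1) (@chart_img_open _ _ _ c2)
  (finsler_local F1 c1) (finsler_local F2 c2) (fun z => f_gt0 _) (f_smooth c)
  energy_twisted (row_mx x u) n1_gt0 n2_gt0 Uz.
have d1E h : partial (lshift n2 h) r (row_mx x u) = df1 f c1 c2 h x u.
  by rewrite -df1E row_mxKl row_mxKr.
have d2E b : partial (rshift n1 b) r (row_mx x u) = df2 f c1 c2 b x u.
  by rewrite -df2E row_mxKl row_mxKr.
have rE : f (Defs.point c (row_mx x u)) = floc f c1 c2 x u.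
  by rewrite /= row_mxKl row_mxKr.
have KE : (fun v => (\sum_b partial (rshift n1 b) r (row_mx x u) *
      mean_cartan (F2 c2) b (rsubmx (row_mx x u)) v) *
      energy (F2 c2) (rsubmx (row_mx x u)) v) =
    fun v => (\sum_nu df2 f c1 c2 nu x u * mean_cartan (F2 c2) nu u v) *
      energy (F2 c2) u v.
  apply/funext => v; rewrite row_mxKr; apply: (congr1 (fun t => t * _)).
  by apply: eq_bigr => b _; rewrite d2E.
rewrite KE rE row_mxKl row_mxKr => H; apply: (iff_trans H) => {H}.
have JE y : \sum_l partial (lshift n2 l) r (row_mx x u) *
    mean_cartan (F1 c1) l x y =
    \sum_h mean_cartan (F1 c1) h x y * df1 f c1 c2 h x u.
  by apply: eq_bigr => h _; rewrite d1E mulrC.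
split=> -[A B C]; split => // y y0.
- by rewrite -JE; exact: B.
- by rewrite JE; exact: B.
Qed.

End TwistedCharts.

Theorem theorem9 (R : realType) (n1 n2 : nat)
    (hn1 : (0 < n1)%N) (hn2 : (0 < n2)%N)
    (M1 : manifold R n1) (M2 : manifold R n2)
    (F1 : finsler_metric M1) (F2 : finsler_metric M2)
    (f : prod_manifold M1 M2 -> R)
    (f_smooth : smooth_fun f) (f_gt0 : forall p, 0 < f p) :
  weakly_berwald twisted_slit (twisted F1 F2 f) <->
  [/\ weakly_berwald slit F1,
      (forall (c1 : chart M1) (c2 : chart M2) (x y : 'rV[R]_n1) (u : 'rV[R]_n2),
         chart_img c1 x -> chart_img c2 u -> y != 0 ->
         \sum_h mean_cartan (F1 c1) h x y * df1 f c1 c2 h x u = 0)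
    & (forall (c1 : chart M1) (c2 : chart M2) (x : 'rV[R]_n1) (u v : 'rV[R]_n2)
              (a b : 'I_n2),
         chart_img c1 x -> chart_img c2 u -> v != 0 ->
         mean_berwald (F2 c2) a b u v =
         - (2^-1 * (floc f c1 c2 x u)^-1 *
            (\sum_nu pdy b (pdy a (mean_cartan (F2 c2) nu)) u v *
                     df2 f c1 c2 nu x u) * F2 c2 u v ^+ 2)
         - (floc f c1 c2 x u)^-1 *
           \sum_nu df2 f c1 c2 nu x u *
             (\sum_g pdy b (cartan2 (F2 c2) g nu a) u v * lower (F2 c2) g u v
              + pdy a (mean_cartan (F2 c2) nu) u v * lower (F2 c2) b u v
              + pdy b (mean_cartan (F2 c2) nu) u v * lower (F2 c2) a u v
              + cartan1 (F2 c2) nu a b u v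
              + mean_cartan (F2 c2) nu u v * fund (F2 c2) u v a b))].
Proof.
have E c1 c2 x u (Ux : chart_img c1 x) (Uu : chart_img c2 u) :=
  twisted_chart_weakly_berwald F1 F2 hn1 hn2 f_smooth f_gt0 Ux Uu.
(* The condition on [F1] does not mention [M2], but it is read off in a product chart; some point of
   [M2] has to be supplied. *)
have [p2 _] := @mfd_nonempty _ _ M2; have [k2 Uk2] := chart_cover p2.
have HE (c1 : chart M1) (c2 : chart M2) (x : 'rV[R]_n1) (u v : 'rV[R]_n2) a b :
    chart_img c2 u -> v != 0 -> _ :=
  fun Uu v0 => hessian_mean_cartan_form_energy
    (local_energy_smooth (finsler_local F2 c2) Uu)
    (local_homog (finsler_local F2 c2) Uu) (local_posdef (finsler_local F2 c2) Uu)
    (fun nu => df2 f c1 c2 nu x u) (floc f c1 c2 x u)^-1 a b v0.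
split=> [WB | [WB1 J0 WB2] c z w [Uz1 Uz2] Tw].
- have {}WB c1 c2 x u (Ux : chart_img c1 x) (Uu : chart_img c2 u) :
      forall w, twisted_slit w -> forall i j,
      mean_berwald (twisted F1 F2 f (c1, c2)) i j (row_mx x u) w = 0.
    by move=> w Tw; apply: WB => //; rewrite /= row_mxKl row_mxKr.
  split.
  + move=> c x y Ux y0.
    have Uu := coord_img Uk2.
    by have [+ _ _] := (E c k2 x _ Ux Uu).1 (WB _ _ _ _ Ux Uu); exact.
  + move=> c1 c2 x y u Ux Uu.
    by have [_ + _] := (E c1 c2 x u Ux Uu).1 (WB _ _ _ _ Ux Uu); exact.
  + move=> c1 c2 x u v a b Ux Uu v0; rewrite (HE c1 c2 x u v a b Uu v0).
    by have [_ _ +] := (E c1 c2 x u Ux Uu).1 (WB _ _ _ _ Ux Uu); exact.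
- case: c Uz1 Uz2 => c1 c2 /= Uz1 Uz2.
  rewrite -[z]hsubmxK; apply: (E c1 c2 _ _ Uz1 Uz2).2 Tw; split.
  + by move=> y y0 j k; exact: WB1.
  + by move=> y y0; exact: J0.
  + by move=> v v0 a b; rewrite -(HE c1 c2 _ _ v a b Uz2 v0); exact: WB2.
Qed.
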